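(* Let $\overline{w}_n=(w_1^{(n)},\ldots,w_n^{(n)})$, $n\in\mathbb{N}$, be a sequence of expected degree sequences satisfying Assumptions A1, A2 and A3 (stated in the context), and let $\mathbf{A}_n$ be the normalized random adjacency matrix of the associated Chung–Lu random graph, with empirical spectral distribution $\mathbf{F}_n$. Then, with probability one, $\mathbf{F}_n(\cdot)$ converges weakly, as $n\to\infty$, to a deterministic distribution $F(\cdot)$, which is uniquely determined by its moments $m_k=\int_{-\infty}^{+\infty}x^k\,dF(x)$. The moments of $F$ are given by $$m_{2s}=\sum_{\overline{r}\in\mathcal{R}_s}\frac{2}{s+1}\binom{s+1}{r_1,\ldots,r_s}\Lambda_1^{r_1}\Lambda_2^{r_2}\cdots\Lambda_s^{r_s}\quad\text{for all } s\in\mathbb{N},\qquad m_{2s+1}=0\quad\text{for all } s\in\mathbb{N}_0,$$ where $\mathcal{R}_s=\{\overline{r}=(r_1,\ldots,r_s)\in\mathbb{N}_0^s:\ \sum_{j=1}^s r_j=s+1,\ \sum_{j=1}^s j\,r_j=2s\}$ and $\Lambda_k=\lim_{n\to\infty}\frac1n\sum_{i=1}^n\left(n\rho_n w_i^{(n)}\right)^k$.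
   Context: Notation: $\mathbb{N}=\{1,2,\ldots\}$, $\mathbb{N}_0=\{0\}\cup\mathbb{N}$, $[n]=\{1,\ldots,n\}$. Asymptotic notation (as $n\to\infty$): $f(n)=O(g(n))$ means $\limsup|f(n)/g(n)|<\infty$; $f(n)=o(h(n))$ means $\lim|f(n)/h(n)|=0$; $h(n)=\omega(f(n))$ means $f(n)=o(h(n))$. $\binom{s+1}{r_1,\ldots,r_s}=\frac{(s+1)!}{r_1!\cdots r_s!}$ is the multinomial coefficient. Model (Chung–Lu random graph with self-loops allowed). For each $n$, $\overline{w}_n=(w_1^{(n)},\ldots,w_n^{(n)})$ is a vector of non-negative reals with positive sum, and $\rho_n=1/\sum_{i=1}^n w_i^{(n)}$. The $n(n+1)/2$ random variables $\mathbf{a}_{ij}^{(n)}$, $1\le i\le j\le n$, are independent, $\{0,1\}$-valued, with $\mathbb{P}\{\mathbf{a}_{ij}^{(n)}=1\}=\rho_n w_i^{(n)}w_j^{(n)}$, and $\mathbf{a}_{ji}^{(n)}=\mathbf{a}_{ij}^{(n)}$. The normalized adjacency matrix is the real symmetric matrix $\mathbf{A}_n=\sqrt{n\rho_n}\,[\mathbf{a}_{ij}^{(n)}]_{i,j=1}^n$. The matrices for all $n$ are defined on one probability space, with the product probability measure $\mathbb{P}$ over $n\in\mathbb{N}$ (so the matrices for different $n$ are independent); ''almost surely''/''with probability one'' refers to $\mathbb{P}$. The empirical spectral distribution is $\mathbf{F}_n(x)=\frac1n\,\mathrm{card}\{i\in[n]:\lambda_i(\mathbf{A}_n)\le x\}$,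 where $\lambda_1(\mathbf{A}_n)\le\cdots\le\lambda_n(\mathbf{A}_n)$ are the eigenvalues of $\mathbf{A}_n$. Put $\hat w_n=\max_{i\in[n]}w_i^{(n)}$, $\check w_n=\min_{i\in[n]}w_i^{(n)}$, and $\tilde d_n=\sum_{i=1}^n (w_i^{(n)})^2\big/\sum_{i=1}^n w_i^{(n)}$ (the second-order average degree). Assumptions: A1: $\rho_n\hat w_n^2<1$ for all $n$, and $\rho_n\hat w_n^2=o(1)$. A2: for every $k\in\mathbb{N}$ the limit $\Lambda_k=\lim_{n\to\infty}\frac1n\sum_{i=1}^n(n\rho_n w_i^{(n)})^k$ exists and is finite. A3: (i) $\hat w_n/\check w_n=O(\log n)$; (ii) $\rho_n\hat w_n^2=\omega(1/n)$; (iii) $n\rho_n=o(1)$; (iv) $n\rho_n\hat w_n=O(1)$; (v) $\hat w_n=O(\log n)$; (vi) $\tilde d_n=o(n/\log n)$. *)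

(* Defs.v *)
From HB Require Import structures.
From mathcomp Require Import all_boot all_order all_algebra.
From mathcomp Require Import polyrcf.
From mathcomp Require Import all_classical all_reals all_analysis.
Set Implicit Arguments.
Unset Strict Implicit.
Unset Printing Implicit Defensive.
Import Order.TTheory GRing.Theory Num.Theory.
Import numFieldNormedType.Exports.
Local Open Scope classical_set_scope.
Local Open Scope ring_scope.

(* A sequence of weight vectors is w : forall n, 'I_n -> R; the index n ranges
   over the positive integers, so the (empty) vector w 0 is ignored. *)
Section Weights.
Context {R : realType}.
Implicit Types (w : forall n : nat, 'I_n -> R) (n k : nat).

Definition expected_degrees w : Prop :=
  forall n, (0 < n)%N -> (forall i, 0 <= w n i) /\ 0 < \sum_(i < n) w n i.

Definition rho w n : R := (\sum_(i < n) w n i)^-1.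

(* The weights are nonnegative, so the initial value 0 does not affect the
   maximum; and wmax is an upper bound, so it does not affect the minimum. *)
Definition wmax w n : R := \big[Num.max/0]_(i < n) w n i.
Definition wmin w n : R := \big[Num.min/wmax w n]_(i < n) w n i.

(* second-order average degree *)
Definition davg2 w n : R := (\sum_(i < n) w n i ^+ 2) / (\sum_(i < n) w n i).

Definition wmoment w k n : R :=
  n%:R^-1 * \sum_(i < n) (n%:R * rho w n * w n i) ^+ k.

Definition Lambda w k : R := limn (wmoment w k).

Definition assumption_A1 w : Prop :=
  (forall n, (0 < n)%N -> rho w n * wmax w n ^+ 2 < 1) /\
  (fun n => rho w n * wmax w n ^+ 2) =o_\oo (fun=> 1 : R).

Definition assumption_A2 w : Prop :=
  forall k, (0 < k)%N -> cvgn (wmoment w k).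

(* Since x / 0 = 0 here, the meaning of the quotient wmax / wmin requires
   stating separately that its denominator is (eventually) positive.
   f = omega(g) is rendered by its definition g = o(f). *)
Definition assumption_A3 w : Prop :=
  [/\ (\forall n \near \oo, 0 < wmin w n) /\
        (fun n => wmax w n / wmin w n) =O_\oo (fun n => ln (n%:R : R)),
      (fun n => 1 / n%:R : R) =o_\oo (fun n => rho w n * wmax w n ^+ 2),
      (fun n => n%:R * rho w n) =o_\oo (fun=> 1 : R),
      (fun n => n%:R * rho w n * wmax w n) =O_\oo (fun=> 1 : R)
    & wmax w =O_\oo (fun n => ln (n%:R : R)) /\
      davg2 w =o_\oo (fun n => n%:R / ln (n%:R : R))].

End Weights.

Section RandomMatrix.
Context {R : realType} {d : measure_display} {T : measurableType d}.
Variable P : probability T R.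

(* mutual independence of the variables X k with k in D, by the product rule
   over the finite subfamilies *)
Definition independent_on {d' : measure_display} {U : measurableType d'}
    {I : eqType} (D : set I) (X : I -> T -> U) : Prop :=
  forall (s : seq I) (B : I -> set U),
    uniq s -> (forall k, k \in s -> D k) ->
    (forall k, k \in s -> measurable (B k)) ->
    P (\bigcap_(k in [set` s]) X k @^-1` B k)
      = (\prod_(k <- s) P (X k @^-1` B k))%E.

(* Independence is required jointly over all n and all pairs i <= j, i.e. both
   within each graph and between the graphs of different sizes. *)
Definition chung_lu (w : forall n : nat, 'I_n -> R)
    (a : forall n : nat, 'I_n -> 'I_n -> {RV P >-> bool}) : Prop :=
  [/\ forall n (i j : 'I_n), (i <= j)%N ->
        P [set t | a n i j t] = (rho w n * w n i * w n j)%:E,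
      forall n (i j : 'I_n) t, a n j i t = a n i j t
    & independent_on
        [set k : {n : nat & ('I_n * 'I_n)%type} |
           ((tagged k).1 <= (tagged k).2)%N]
        (fun k => a (tag k) (tagged k).1 (tagged k).2 : T -> bool)].

Definition normalized_adjacency (w : forall n : nat, 'I_n -> R)
    (a : forall n : nat, 'I_n -> 'I_n -> {RV P >-> bool}) (n : nat) (t : T) :
    'M[R]_n :=
  Num.sqrt (n%:R * rho w n) *: \matrix_(i, j) (a n i j t)%:R.

End RandomMatrix.

(* The real eigenvalues in nondecreasing order, each repeated according to its
   multiplicity as a root of the characteristic polynomial; for a symmetric
   matrix of size n there are n of them. *)
Definition eigenvalues {R : realType} {n : nat} (A : 'M[R]_n) : seq R :=
  flatten [seq nseq (mup l (char_poly A)) l | l <- rootsR (char_poly A)].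

Definition esd {R : realType} {n : nat} (A : 'M[R]_n) (x : R) : R :=
  n%:R^-1 * (count (fun l => l <= x) (eigenvalues A))%:R.

Section Distributions.
Context {R : realType}.
Implicit Types mu nu : probability (measurableTypeR R) R.

Definition distribution_function mu (x : R) : R := fine (mu [set y : R | y <= x]).

Definition cvg_weakly (Fn : nat -> R -> R) (F : R -> R) : Prop :=
  forall x : R, {for x, continuous F} -> Fn n x @[n --> \oo] --> F x.

Definition has_moment mu (k : nat) (m : R) : Prop :=
  mu.-integrable setT (fun x : R => (x ^+ k)%:E) /\
  (\int[mu]_x (x ^+ k)%:E = m%:E)%E.

Definition determined_by_moments mu : Prop :=
  exists2 m : nat -> R, forall k, has_moment mu k (m k) &
    forall nu, (forall k, has_moment nu k (m k)) ->
      forall B : set (measurableTypeR R), measurable B -> nu B = mu B.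

End Distributions.

(* A tuple r_1, .., r_s is a finite function r on
   'I_s, the entry r_j being r applied to the ordinal of value j - 1. The bound
   r_j <= s + 1 built into the codomain is implied by \sum_j r_j = s + 1. *)
Definition in_Rs (s : nat) (r : {ffun 'I_s -> 'I_s.+2}) : bool :=
  (\sum_(j < s) r j == s.+1)%N && (\sum_(j < s) j.+1 * r j == 2 * s)%N.

Definition multinomial {R : realType} (s : nat) (r : {ffun 'I_s -> 'I_s.+2}) :
    R :=
  (s.+1)`!%:R / \prod_(j < s) (r j)`!%:R.

Definition even_moment {R : realType} (L : nat -> R) (s : nat) : R :=
  \sum_(r : {ffun 'I_s -> 'I_s.+2} | in_Rs r)
    2 / s.+1%:R * multinomial r * \prod_(j < s) L j.+1 ^+ r j.

(* Main.v *)
Require Import Defs.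
From HB Require Import structures.
From mathcomp Require Import all_boot all_order all_algebra.
From mathcomp Require Import polyrcf complex.
From mathcomp Require Import all_classical all_reals all_analysis.
From mathcomp Require Import measurable_realfun.
From mathcomp Require Import zify ring lra.
Import Order.TTheory GRing.Theory Num.Theory.
Import numFieldNormedType.Exports.
Local Open Scope classical_set_scope.
Local Open Scope ring_scope.

Set Implicit Arguments.
Unset Strict Implicit.
Unset Printing Implicit Defensive.

(** Put [x_i = n * rho * w_i] and [s = sqrt (n * rho)]. The entry [(i, j)] of the
    matrix [A] is [s] with probability [x_i * x_j / (n * s ^ 2)] and 0 otherwise.
    The [x_i] are bounded with mean 1 and [s] tends to 0, but slowly: the mean
    degree [s ^ -2] is at most logarithmic, so that [n] dominates every power of
    [1 / s] ([mesh_pow_cvg0]).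

    Expected moments. The mean of [tr (A ^ k) / n] is a sum over closed walks, in
    which every step costs [s] and every distinct edge its probability. Follow a
    walk step by step, with a factor [s ^ h] set aside at depth [h]: discovering
    a vertex [y] from [u] weighs [x_u * x_y / n], returning to the parent weighs
    1, repeating a step down a known edge loses [s ^ 2], and closing a cycle
    loses a factor [n] up to powers of [s]. In the limit only the contours of
    plane trees survive ([walk_sum_approx]), hence no odd moment, and a vertex of
    degree [j] contributes [Lambda_j]. Reading the trees vertex by vertex instead
    of along their contour ([stack_sumE]) turns the sum into a linear recursion
    that Lagrange inversion solves ([luk_lagrange], [luk_sum]); the multinomial
    theorem expands the solution into the stated formula
    ([luk_sum_even_moment]). This works without centering the matrix, because
    the mean of [A] only shows in walks with cycles.

    The limit law. The limiting moments grow at most exponentially. For such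
    moments the indicator of a half-line is squeezed between two polynomials
    whose integrals are close, except for a small shift of the half-line
    ([cdf_sandwich]). Therefore the least integral of a polynomial majorant
    ([dual_cdf]) is a distribution function, the distribution functions of any
    measures with converging moments converge to it ([cdf_limit_ub],
    [cdf_limit_lb]), it has the right moments ([is_cdf_of_moments]), and no other
    measure has them ([is_cdf_of_unique]).

    Almost sure convergence. Modifying one row and one column perturbs a
    symmetric matrix by rank at most 2 and its spectral distribution function by
    at most [2 / n] ([esd_cross_change]). Exposing the vertices one by one gives
    a martingale with [n] bounded increments, so the deviation of the spectral
    distribution function from its mean has a fourth moment of order [n ^ -2]
    ([esd_concentration]), which is summable. By the Borel-Cantelli lemma the
    random distribution functions share the limit of their means
    ([esd_ae_rat], [cvg_weakly_rat]). *)

(** * Majorizing half-lines by polynomials *)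

Lemma cvgr_sum {R : realType} {T I : Type} (F : set_system T) (r : seq I)
    (f : I -> T -> R) (a : I -> R) : Filter F ->
  (forall i, f i x @[x --> F] --> a i) ->
  \sum_(i <- r) f i x @[x --> F] --> \sum_(i <- r) a i.
Proof.
move=> FF fa; apply: (@cvg_big R I +%R 0 xpredT) => // x; exact: add_continuous.
Qed.

Section MomentFunctional.
Context {R : realType}.
Implicit Types (m : nat -> R) (p q : {poly R}) (x y K B e : R) (G : R -> R).

(** The value at [p] of the linear functional with moments [m]. *)
Definition mom m p : R := \sum_(i < size p) p`_i * m i.

Lemma mom_widen m p N : (size p <= N)%N -> mom m p = \sum_(i < N) p`_i * m i.
Proof.
move=> pN; rewrite /mom (big_ord_widen N (fun i => p`_i * m i) pN) big_mkcond.
by apply: eq_bigr => i _; case: ltnP => // pi; rewrite nth_default // mul0r.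
Qed.

Lemma momD m p q : mom m (p + q) = mom m p + mom m q.
Proof.
pose N := maxn (size p) (size q).
rewrite (@mom_widen m p N) ?leq_maxl // (@mom_widen m q N) ?leq_maxr //.
rewrite (@mom_widen m (p + q) N) ?size_polyD // -big_split /=.
by apply: eq_bigr => i _; rewrite coefD mulrDl.
Qed.

Lemma momZ m c p : mom m (c *: p) = c * mom m p.
Proof.
rewrite (@mom_widen m (c *: p) (size p)) ?size_scale_leq // mulr_sumr.
by apply: eq_bigr => i _; rewrite coefZ mulrA.
Qed.

Lemma momN m p : mom m (- p) = - mom m p.
Proof. by rewrite -scaleN1r momZ mulN1r. Qed.

Lemma momB m p q : mom m (p - q) = mom m p - mom m q.
Proof. by rewrite momD momN. Qed.

Lemma momXn m k : mom m 'X^k = m k.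
Proof.
rewrite /mom size_polyXn big_ord_recr /= coefXn eqxx mul1r big1 ?add0r // => i _.
by rewrite coefXn ltn_eqF // mul0r.
Qed.

Lemma momC m c : mom m c%:P = c * m 0%N.
Proof. by rewrite -alg_polyC momZ -(expr0 'X) momXn. Qed.

Lemma mom_sum m (J : Type) (r : seq J) (F : J -> {poly R}) :
  mom m (\sum_(j <- r) F j) = \sum_(j <- r) mom m (F j).
Proof.
elim: r => [|j r IH]; last by rewrite !big_cons momD IH.
by rewrite !big_nil -(scale0r 0) momZ mul0r.
Qed.

Definition moment_growth K m := forall j, m j.*2 <= K ^+ j.*2.

Lemma small_pow (r M e : R) N : 0 <= r < 1 -> 0 < e ->
  exists2 j, (N <= j)%N & M * r ^+ j <= e.
Proof.
move=> /andP[r0 r1] e0.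
have : M * r ^+ j @[j --> \oo] --> M * 0.
  by apply: cvgMr; apply: cvg_expr; rewrite ger0_norm.
rewrite mulr0 => /cvgrPdist_le /(_ _ e0)[j0 _ jP].
exists (maxn N j0); first exact: leq_maxl.
have := jP (maxn N j0) (leq_maxr _ _); rewrite sub0r normrN.
exact: le_trans (ler_norm _).
Qed.

(** Outside [-B, B] a polynomial is dominated by a large even power of
    [y / B], whose moment is negligible as soon as [B] exceeds the growth rate
    of the moments; hence only the values on [-B, B] matter. *)
Lemma globalize_majorant m K B (f : R -> R) p e :
  moment_growth K m -> 0 <= K < B -> 0 < e -> (forall y, f y <= 1) ->
  (forall y, `|y| <= B -> f y <= p.[y]) ->
  exists2 p', (forall y, f y <= p'.[y]) & mom m p' <= mom m p + e.
Proof.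
move=> mK /andP[K0 KB] e0 f1 fp.
have B0 : 0 < B by exact: le_lt_trans KB.
pose M := \sum_(i < size p) `|p`_i| * B ^+ i + 1.
have M0 : 0 <= M by rewrite addr_ge0 ?sumr_ge0 // => i _; rewrite mulr_ge0 // exprn_ge0 // ltW.
have KB0 : 0 <= K / B by exact: divr_ge0 K0 (ltW B0).
have [|j jp je] := @small_pow ((K / B) ^+ 2) M e (size p) _ e0.
  by rewrite exprn_ge0 ?KB0 //= expr_lt1 ?KB0 // ltr_pdivrMr ?mul1r.
exists (p + (M / B ^+ j.*2) *: 'X^(j.*2)) => [y|]; last first.
  rewrite momD lerD2l momZ momXn; apply: le_trans je.
  rewrite mulrAC -mulrA ler_wpM2l // -exprM mul2n expr_div_n.
  by rewrite ler_wpM2r ?invr_ge0 ?exprn_ge0 // ltW.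
rewrite hornerD hornerZ hornerXn mulrAC -mulrA -expr_div_n.
have ev : 0 <= (y / B) ^+ j.*2 by rewrite exprn_even_ge0 // odd_double.
have [yB|By] := leP `|y| B.
  by rewrite (le_trans (fp y yB)) // lerDl mulr_ge0.
have yB1 : 1 <= `|y / B|.
  by rewrite normf_div (gtr0_norm B0) ler_pdivlMr // mul1r ltW.
have evE : (y / B) ^+ j.*2 = `|y / B| ^+ j.*2 by rewrite -normrX ger0_norm.
apply: le_trans (f1 y) _; rewrite -lerBlDl.
apply: le_trans (_ : 1 + \sum_(i < size p) `|p`_i| * `|y| ^+ i <= _).
  rewrite lerD2l; apply: le_trans (ler_norm _) _; rewrite normrN horner_coef.
  apply: le_trans (ler_norm_sum _ _ _) _.
  by apply: ler_sum => i _; rewrite normrM normrX.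
rewrite /M mulrDl mul1r addrC lerD ?evE ?exprn_ege1 // mulr_suml.
apply: ler_sum => i _; rewrite -mulrA ler_wpM2l //.
have -> : `|y| ^+ i = B ^+ i * `|y / B| ^+ i.
  by rewrite normf_div (gtr0_norm B0) -exprMn mulrC divfK ?gt_eqF.
rewrite ler_wpM2l ?(exprn_ge0 _ (ltW B0)) //; apply: ler_weXn2l => //.
by rewrite -addnn (leq_trans (ltnW (ltn_ord i))) // (leq_trans jp) // leq_addr.
Qed.

(** [G] and the numbers [m] behave as the distribution function and the moments
    of one measure, as far as can be expressed by comparing indicators of
    half-lines with polynomials. This is shared by averaged spectral
    distributions, by probability measures and by limits of such. *)
Record is_cdf_of m G : Prop := IsCdfOf {
  cdf_mom0 : m 0%N = 1;
  cdf_mom_ge0 : forall p, (forall y, 0 <= p.[y]) -> 0 <= mom m p;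
  cdf_mom_ub : forall p x, (forall y, (y <= x)%R%:R <= p.[y]) -> G x <= mom m p;
  cdf_mom_lb : forall p x, (forall y, p.[y] <= (y <= x)%R%:R) -> mom m p <= G x }.

Lemma mom_cst m c : m 0%N = 1 -> mom m c%:P = c.
Proof. by move=> m0; rewrite momC m0 mulr1. Qed.

Section Local.
Variables (m : nat -> R) (K B : R).
Hypotheses (mK : moment_growth K m) (KB : 0 <= K < B).

Lemma mom_ge0_local G p : is_cdf_of m G ->
  (forall y, `|y| <= B -> 0 <= p.[y]) -> 0 <= mom m p.
Proof.
move=> mG p0; apply/ler_addgt0Pr => e e0.
have [p' p'0] := globalize_majorant mK KB e0 (fun=> ler01 : (0 : R) <= 1) p0.
exact: le_trans (cdf_mom_ge0 mG p'0).
Qed.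

Lemma mom_ub_local G p x : is_cdf_of m G ->
  (forall y, `|y| <= B -> (y <= x)%R%:R <= p.[y]) -> G x <= mom m p.
Proof.
move=> mG px; apply/ler_addgt0Pr => e e0.
have f1 y : ((y <= x)%R%:R : R) <= 1 by rewrite lern1 leq_b1.
have [p' p'x] := globalize_majorant mK KB e0 f1 px.
exact: le_trans (cdf_mom_ub mG p'x).
Qed.

Lemma mom_lb_local G p x : is_cdf_of m G ->
  (forall y, `|y| <= B -> p.[y] <= (y <= x)%R%:R) -> mom m p <= G x.
Proof.
move=> mG px; rewrite -lerN2 -momN; apply/ler_addgt0Pr => e e0.
have f1 y : - ((y <= x)%R%:R : R) <= 1 by rewrite (@le_trans _ _ 0) // lerNl oppr0.
have px' y : `|y| <= B -> - (y <= x)%R%:R <= (- p).[y].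
  by move=> yB; rewrite hornerN lerN2 px.
have [p' p'x] := globalize_majorant mK KB e0 f1 px'.
move=> le; apply: le_trans le; rewrite lerNl -momN; apply: (cdf_mom_lb mG) => y.
by rewrite hornerN lerNl.
Qed.

Lemma mom_norm_le_local G p c : is_cdf_of m G ->
  (forall y, `|y| <= B -> `|p.[y]| <= c) -> `|mom m p| <= c.
Proof.
move=> mG pc; rewrite -(mom_cst c (cdf_mom0 mG)) ler_norml -momN.
by apply/andP; split; rewrite -subr_ge0 -momB; apply: (mom_ge0_local mG) => y yB;
  have := pc y yB; rewrite ?hornerD ?hornerN hornerC ler_norml subr_ge0 => /andP[].
Qed.

End Local.

Lemma bernoulli_ge (t : R) n : 0 <= t <= 1 -> 1 - n%:R * t <= (1 - t) ^+ n.
Proof.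
move=> /andP[t0 t1]; elim: n => [|n IH]; first by rewrite mul0r subr0 expr0.
rewrite exprSr; apply: le_trans (_ : (1 - n%:R * t) * (1 - t) <= _); last first.
  by rewrite ler_wpM2r // subr_ge0.
have : 0 <= n%:R * t ^+ 2 by rewrite mulr_ge0 // exprn_ge0.
by rewrite -natr1; nra.
Qed.

Lemma bernoulli_le (t : R) n : 0 <= t <= 1 -> (1 - t) ^+ n * (1 + n%:R * t) <= 1.
Proof.
move=> /andP[t0 t1]; elim: n => [|n IH]; first by rewrite mul0r addr0 expr0 mul1r.
apply: le_trans IH; rewrite exprSr -mulrA ler_wpM2l ?exprn_ge0 ?subr_ge0 //.
have : 0 <= n%:R * t ^+ 2 by rewrite mulr_ge0 // exprn_ge0.
have := exprn_ge0 2 t0; rewrite -natr1; nra.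
Qed.

(** The polynomials [(1 - u ^ n) ^ (k ^ n)] drop from 1 to 0 on [0, 1] around
    [u = 1 / k], by Bernoulli's inequality in both directions. *)
Lemma ramp_poly B x x' e : `|x| < B -> `|x'| < B -> x < x' -> 0 < e ->
  exists P : {poly R}, forall y, `|y| <= B ->
    [/\ 0 <= P.[y] <= 1, y <= x -> 1 - e <= P.[y] & x' <= y -> P.[y] <= e].
Proof.
rewrite !ltr_norml => /andP[xB xB'] /andP[x'B x'B'] xx' e0.
pose z := (x + x') / 2; have xz : x < z by rewrite /z; lra.
have zx' : z < x' by rewrite /z; lra.
have zB : 0 < z + B by lra.
(* The affine map [u] sends [-B, B] into [0, 1] and the midpoint [z] to [1 / k]. *)
have [k k0 kB] : exists2 k, (0 < k)%N & 2 * B <= k%:R * (z + B).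
  exists (Num.bound (2 * B / (z + B))).+1 => //.
  have zB' : 0 <= 2 * B / (z + B) by rewrite divr_ge0 //; lra.
  by rewrite -ler_pdivrMr // (le_trans (ltW (archi_boundP zB'))) // ler_nat.
have k0R : 0 < k%:R :> R by rewrite ltr0n.
pose S := k%:R * (z + B); have S0 : 0 < S by rewrite mulr_gt0.
pose al := (x + B) / (z + B); pose be := (z + B) / (x' + B).
have al01 : 0 <= al < 1.
  by rewrite divr_ge0 ?ltr_pdivrMr ?mul1r //=; lra.
have be01 : 0 <= be < 1.
  by rewrite divr_ge0 ?ltr_pdivrMr ?mul1r //=; lra.
have [n1 n1P] : exists n1, forall n, (n1 <= n)%N -> al ^+ n <= e /\ be ^+ n <= e.
  have [a _ ae] := small_pow 1 0 al01 e0; have [b _ be'] := small_pow 1 0 be01 e0.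
  exists (maxn a b) => n; rewrite geq_max => /andP[an bn]; rewrite !mul1r in ae be'.
  move: al01 be01 => /andP[? ?] /andP[? ?].
  by split; [apply: le_trans ae|apply: le_trans be']; apply: ler_wiXn2l => //; exact: ltW.
pose n := n1.+1; have [ale bee] := n1P n (leqnSn _).
pose u : {poly R} := S^-1 *: ('X + B%:P).
exists ((1 - u ^+ n) ^+ (k ^ n)) => y; rewrite ler_norml => /andP[yB yB'].
have uE : u.[y] = (y + B) / S by rewrite hornerZ hornerD hornerX hornerC mulrC.
have u01 : 0 <= u.[y] <= 1.
  have yB0 : 0 <= y + B by lra.
  have yS : y + B <= S by rewrite /S; lra.
  by rewrite uE divr_ge0 ?(ltW S0) //= ler_pdivrMr // mul1r.
have t01 : 0 <= u.[y] ^+ n <= 1.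
  by case/andP: u01 => u0 u1; rewrite exprn_ge0 // exprn_ile1.
rewrite horner_exp hornerD hornerN hornerC horner_exp.
have NuE : (k ^ n)%:R * u.[y] ^+ n = ((y + B) / (z + B)) ^+ n.
  rewrite uE natrX -exprMn; congr (_ ^+ _).
  by rewrite /S; field; rewrite !gt_eqF.
case/andP: (t01) => t0 t1.
split.
- by rewrite exprn_ge0 ?exprn_ile1 ?subr_ge0 // lerBlDr lerDl.
- move=> yx; apply: le_trans (bernoulli_ge (k ^ n) t01).
  rewrite lerD2l lerN2 NuE; apply: le_trans ale.
  rewrite lerXn2r ?nnegrE ?divr_ge0 ?ler_pM2r ?invr_gt0 //; lra.
- move=> yx'; have := bernoulli_le (k ^ n) t01; rewrite NuE.
  have y0 : 0 < ((y + B) / (z + B)) ^+ n by rewrite exprn_gt0 // divr_gt0 //; lra.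
  rewrite -ler_pdivlMr; last lra.
  move=> le; apply: le_trans le _; apply: le_trans bee.
  rewrite mul1r; apply: le_trans (_ : (((y + B) / (z + B)) ^+ n)^-1 <= _).
    by rewrite lef_pV2 ?posrE ?lerDr //; lra.
  rewrite -exprVn invf_div lerXn2r ?nnegrE ?divr_ge0 //; [lra|lra|lra|lra|].
  by rewrite ler_pM2l // lef_pV2 ?posrE; lra.
Qed.

Lemma sandwich_local B x x' e : `|x| < B -> `|x'| < B -> x < x' -> 0 < e ->
  exists P : {poly R}, forall y, `|y| <= B ->
    (y <= x)%R%:R <= (P + e%:P).[y] /\ (P - e%:P).[y] <= (y <= x')%R%:R.
Proof.
move=> xB x'B xx' e0; have [P Pr] := ramp_poly xB x'B xx' e0.
exists P => y yB; have [/andP[P0 P1] Px Px'] := Pr y yB.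
rewrite !hornerD hornerN !hornerC; split.
  by case: (leP y x) => [/Px|_] /=; lra.
by case: (leP y x') => [|/ltW /Px'] /=; lra.
Qed.

(** The two bounds are one ramp, raised to a majorant and lowered to a minorant. *)
Lemma cdf_sandwich m K x x' e : moment_growth K m -> 0 <= K -> m 0%N = 1 ->
  x < x' -> 0 < e ->
  exists p q, [/\ forall y, (y <= x)%R%:R <= p.[y],
    forall y, q.[y] <= (y <= x')%R%:R & mom m p <= mom m q + e].
Proof.
move=> mK K0 m0 xx' e0; pose B := K + `|x| + `|x'| + 1.
have [xB x'B] : `|x| < B /\ `|x'| < B.
  by have := normr_ge0 x; have := normr_ge0 x'; rewrite /B; split; lra.
have KB : 0 <= K < B.
  by rewrite K0 /B; have := normr_ge0 x; have := normr_ge0 x'; lra.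
have e4 : 0 < e / 4 by rewrite divr_gt0.
have [P Pl] := sandwich_local xB x'B xx' e4.
have f1 y : ((y <= x)%R%:R : R) <= 1 by rewrite lern1 leq_b1.
have g1 y : - ((y <= x')%R%:R : R) <= 1 by rewrite (@le_trans _ _ 0) // lerNl oppr0.
have [p px pe] := globalize_majorant mK KB e4 f1 (fun y yB => (Pl y yB).1).
have Pl2 y : `|y| <= B -> - (y <= x')%R%:R <= (- (P - (e/4)%:P)).[y].
  by move=> yB; rewrite hornerN lerN2; apply: (Pl y yB).2.
have [q qx qe] := globalize_majorant mK KB e4 g1 Pl2.
exists p, (- q); split => //.
  by move=> y; rewrite hornerN lerNl.
move: pe qe; rewrite !(momN, momB, momD) !mom_cst //; lra.
Qed.

(** Uniqueness in the moment problem: a sandwich compares the values of [F] at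
    [x] and of [G] slightly to the right of [x]. *)
Lemma is_cdf_of_unique m K F G : moment_growth K m -> 0 <= K ->
  is_cdf_of m F -> is_cdf_of m G -> right_continuous G -> forall x, F x <= G x.
Proof.
move=> mK K0 mF mG rG x; apply/ler_addgt0Pr => e e0.
have e2 : 0 < e / 2 by rewrite divr_gt0.
have := rG x => /(@cvgrPdist_le _ R^o) /(_ _ e2) near_x.
near x^'+ => y.
have xy : x < y by near: y; exact: nbhs_right_gt.
have yG : `|G x - G y| <= e / 2 by near: y.
have [p [q [px qy pq]]] := cdf_sandwich mK K0 (cdf_mom0 mF) xy e2.
have := cdf_mom_ub mF px; have := cdf_mom_lb mG qy.
move: yG; rewrite ler_norml => /andP[]; lra.
Unshelve. all: end_near. Qed.

(** The limiting distribution function is defined by duality: as a function of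
    the moments only, it is the least value at which a polynomial majorant of
    the indicator of a half-line can be integrated. *)
Definition dual_cdf m x : R :=
  inf [set z | exists2 p, (forall y, (y <= x)%R%:R <= p.[y]) & z = mom m p].

Section DualCdf.
Variables (m : nat -> R) (K : R).
Hypotheses (mK : moment_growth K m) (K0 : 0 <= K) (m0 : m 0%N = 1).
Hypothesis m_ge0 : forall p, (forall y, 0 <= p.[y]) -> 0 <= mom m p.

Let ind_ge0 p x : (forall y, (y <= x)%R%:R <= p.[y]) -> forall y, 0 <= p.[y].
Proof. by move=> px y; apply: le_trans (px y). Qed.

Let dual_has_inf x :
  has_inf [set z | exists2 p, (forall y, (y <= x)%R%:R <= p.[y]) & z = mom m p].
Proof.
split; first by exists (mom m 1%:P), 1%:P => // y; rewrite hornerC lern1 leq_b1.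
by exists 0 => _ [p /ind_ge0/m_ge0 p0 ->].
Qed.

Lemma dual_cdf_ub p x : (forall y, (y <= x)%R%:R <= p.[y]) -> dual_cdf m x <= mom m p.
Proof. by move=> px; apply: (ge_inf (dual_has_inf x).2); exists p. Qed.

Lemma dual_cdf_adherent x e : 0 < e -> exists2 p,
  (forall y, (y <= x)%R%:R <= p.[y]) & mom m p < dual_cdf m x + e.
Proof.
by move=> e0; have [_ [p px ->] pe] := inf_adherent e0 (dual_has_inf x); exists p.
Qed.

Lemma dual_cdf_is_cdf_of : is_cdf_of m (dual_cdf m).
Proof.
split => // [p x|q x qx]; first exact: dual_cdf_ub.
apply: lb_le_inf; first exact: (dual_has_inf x).1.
move=> _ [p px ->]; rewrite -subr_ge0 -momB; apply: m_ge0 => y.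
by rewrite hornerD hornerN subr_ge0 (le_trans (qx y)).
Qed.

Lemma dual_cdf_nondecreasing : {homo dual_cdf m : x y / x <= y}.
Proof.
move=> x x' xx'; apply: lb_le_inf; first exact: (dual_has_inf x').1.
move=> _ [p px ->]; apply: dual_cdf_ub => y; apply: le_trans (px y).
by rewrite ler_nat; case: leP => // yx; rewrite (le_trans yx).
Qed.

(** A polynomial majorant of the indicator of [y <= x], raised by [e], is still
    a majorant when [x] is slightly increased. *)
Lemma dual_cdf_right_continuous : right_continuous (dual_cdf m).
Proof.
move=> x; apply/(@cvgrPdist_le _ R^o) => e e0.
have e2 : 0 < e / 2 by rewrite divr_gt0.
have [p px pe] := dual_cdf_adherent x e2.
have := @continuous_horner _ p x => /(@cvgrPdist_le _ R^o) /(_ _ e2) [d /= d0 dP].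
near=> y.
have xy : x < y by near: y; exact: nbhs_right_gt.
have yd : y < x + d by near: y; apply: nbhs_right_lt; rewrite ltrDl.
have le1 := dual_cdf_nondecreasing (ltW xy).
rewrite distrC ger0_norm ?subr_ge0 // lerBlDl.
apply: le_trans (_ : mom m (p + (e / 2)%:P) <= _); last first.
  by rewrite momD mom_cst //; lra.
apply: dual_cdf_ub => z; rewrite hornerD hornerC.
have [zy|_] := leP z y => /=; last first.
  by rewrite addr_ge0 ?(ind_ge0 px) // ltW.
have [zx|xz] := leP z x.
  by apply: le_trans (_ : p.[z] <= _); [have := px z; rewrite zx|rewrite lerDl ltW].
have := dP z; rewrite /ball /= => /(_ _).
have -> : `|x - z| < d by rewrite distrC gtr0_norm ?subr_gt0 // ltrBlDl; lra.
move=> /(_ isT); rewrite ler_norml => /andP[].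
by have := px x; rewrite lexx /=; lra.
Unshelve. all: end_near. Qed.

(** Convergence of moments gives convergence of distribution functions up to
    the jumps of the limit: a majorant that is almost optimal for the limit is
    a majorant for the whole sequence. *)
Lemma cdf_limit_ub (m_ : nat -> nat -> R) (G : nat -> R -> R) x e :
  (\forall n \near \oo, is_cdf_of (m_ n) (G n)) ->
  (forall k, m_ n k @[n --> \oo] --> m k) -> 0 < e ->
  \forall n \near \oo, G n x <= dual_cdf m x + e.
Proof.
move=> mG mcvg e0; have [p px pe] := dual_cdf_adherent x e0.
have cvgp : mom (m_ n) p @[n --> \oo] --> mom m p.
  by apply: cvgr_sum => i; apply: cvgMr.
have lt : \forall n \near \oo, mom (m_ n) p < dual_cdf m x + e.
  exact: (cvgr_lt _ cvgp _ pe).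
near=> n; apply: le_trans (_ : mom (m_ n) p <= _).
  have nG : is_cdf_of (m_ n) (G n) by near: n.
  exact: cdf_mom_ub nG _ _ px.
by apply: ltW; near: n.
Unshelve. all: end_near. Qed.

Lemma cdf_limit_lb (m_ : nat -> nat -> R) (G : nat -> R -> R) x x' e :
  (\forall n \near \oo, is_cdf_of (m_ n) (G n)) ->
  (forall k, m_ n k @[n --> \oo] --> m k) -> x < x' -> 0 < e ->
  \forall n \near \oo, dual_cdf m x - e <= G n x'.
Proof.
move=> mG mcvg xx' e0; have e2 : 0 < e / 2 by rewrite divr_gt0.
have [p [q [px qx pq]]] := cdf_sandwich mK K0 m0 xx' e2.
have cvgq : mom (m_ n) q @[n --> \oo] --> mom m q.
  by apply: cvgr_sum => i; apply: cvgMr.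
have qe : mom m q - e / 2 < mom m q by rewrite ltrBlDr ltrDl.
near=> n; apply: le_trans (_ : mom (m_ n) q <= _); last first.
  have nG : is_cdf_of (m_ n) (G n) by near: n.
  exact: cdf_mom_lb nG _ _ qx.
have := dual_cdf_ub px.
have : mom m q - e / 2 < mom (m_ n) q by near: n; exact: (cvgr_gt _ cvgq _ qe).
lra.
Unshelve. all: end_near. Qed.

End DualCdf.

(** Chebyshev's inequality, with the majorant [(y / x) ^ 2]. *)
Lemma cdf_le_left m G x : is_cdf_of m G -> x < 0 -> G x <= m 2 / x ^+ 2.
Proof.
move=> mG x0; have -> : m 2 / x ^+ 2 = mom m (x ^- 2 *: 'X^2) by rewrite momZ momXn mulrC.
apply: (cdf_mom_ub mG) => y; rewrite hornerZ hornerXn.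
have y20 : 0 <= x ^- 2 * y ^+ 2.
  by rewrite mulr_ge0 ?invr_ge0 ?exprn_even_ge0.
case: (leP y x) => //= yx.
have x20 : 0 < x ^+ 2 by rewrite exprn_even_gt0 //= lt_eqF.
by rewrite mulrC ler_pdivlMr // mul1r; nra.
Qed.

Lemma cdf_ge_right m G x : is_cdf_of m G -> 0 < x -> 1 - m 2 / x ^+ 2 <= G x.
Proof.
move=> mG x0; have -> : 1 - m 2 / x ^+ 2 = mom m (1%:P - x ^- 2 *: 'X^2).
  by rewrite momB momZ momXn mom_cst 1?mulrC // (cdf_mom0 mG).
apply: (cdf_mom_lb mG) => y; rewrite hornerD hornerN hornerC hornerZ hornerXn.
have y20 : 0 <= x ^- 2 * y ^+ 2.
  by rewrite mulr_ge0 ?invr_ge0 ?exprn_even_ge0.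
case: (leP y x) => /= xy; first by rewrite lerBlDr lerDl.
rewrite subr_le0 mulrC ler_pdivlMr ?exprn_gt0 // mul1r lerXn2r ?nnegrE; lra.
Qed.

Lemma cdf_of_le1 m G x : is_cdf_of m G -> G x <= 1.
Proof.
move=> mG; rewrite -(mom_cst 1 (cdf_mom0 mG)); apply: (cdf_mom_ub mG) => y.
by rewrite hornerC lern1 leq_b1.
Qed.

Lemma cdf_of_ge0 m G x : is_cdf_of m G -> 0 <= G x.
Proof.
move=> mG; rewrite -(mom_cst 0 (cdf_mom0 mG)); apply: (cdf_mom_lb mG) => y.
by rewrite hornerC.
Qed.

Lemma cdf_cvgNy m G : is_cdf_of m G -> G x @[x --> -oo] --> 0.
Proof.
move=> mG; apply/cvgrPdist_le => e e0; near=> x.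
have x1 : x <= -1 by near: x; apply: nbhs_ninfty_le; rewrite num_real.
have xm : x <= - (m 2 / e) by near: x; apply: nbhs_ninfty_le; rewrite num_real.
have x0 : x < 0 by lra.
rewrite sub0r normrN ger0_norm ?(cdf_of_ge0 _ mG) //.
apply: le_trans (cdf_le_left mG x0) _.
have x20 : 0 < x ^+ 2 by rewrite exprn_even_gt0 //= lt_eqF.
rewrite ler_pdivrMr //; move: xm; rewrite lerNr ler_pdivrMr //.
have x10 : 0 <= - 1 - x by rewrite subr_ge0.
have xN : 0 <= - x by lra.
have := mulr_ge0 (mulr_ge0 (ltW e0) xN) x10; nra.
Unshelve. all: end_near. Qed.

Lemma cdf_cvgy m G : is_cdf_of m G -> G x @[x --> +oo] --> (1 : R).
Proof.
move=> mG; apply/cvgrPdist_le => e e0; near=> x.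
have x1 : 1 <= x by near: x; apply: nbhs_pinfty_ge; rewrite num_real.
have xm : m 2 / e <= x by near: x; apply: nbhs_pinfty_ge; rewrite num_real.
have x0 : 0 < x by lra.
rewrite ger0_norm ?subr_ge0 ?(cdf_of_le1 _ mG) // lerBlDr -lerBlDl.
apply: le_trans (cdf_ge_right mG x0); rewrite lerD2l lerN2.
rewrite ler_pdivrMr ?exprn_gt0 //; move: xm; rewrite ler_pdivrMr //.
have x10 : 0 <= x - 1 by rewrite subr_ge0.
have := mulr_ge0 (mulr_ge0 (ltW e0) (ltW x0)) x10; nra.
Unshelve. all: end_near. Qed.

Lemma expr_lipschitz B k : 0 <= B -> exists2 L, 0 <= L &
  forall y z, `|y| <= B -> `|z| <= B -> `|y ^+ k - z ^+ k| <= L * `|y - z|.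
Proof.
move=> B0; elim: k => [|k [L L0 IH]].
  by exists 0 => // y z _ _; rewrite !expr0 subrr normr0 mul0r.
exists (B * L + B ^+ k); first by rewrite addr_ge0 ?mulr_ge0 ?exprn_ge0.
move=> y z yB zB; rewrite !exprS.
have -> : y * y ^+ k - z * z ^+ k = y * (y ^+ k - z ^+ k) + (y - z) * z ^+ k by ring.
rewrite [leRHS]mulrDl; apply: le_trans (ler_normD _ _) _; rewrite !normrM.
apply: lerD; first by rewrite -mulrA ler_pM // IH.
by rewrite mulrC ler_wpM2r // normrX lerXn2r ?nnegrE.
Qed.

Lemma find_cell (t : nat -> R) y N : t 0%N <= y <= t N -> (0 < N)%N ->
  exists2 j, (j < N)%N & t j <= y <= t j.+1.
Proof.
move=> /andP[t0]; elim: N => // N IH yN _.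
have [ltN|leN] := ltP y (t N); last by exists N => //; rewrite leN.
case: N IH ltN yN => [|N] IH ltN yN; first by move: (lt_le_trans ltN t0); rewrite ltxx.
by have [j jN jt] := IH (ltW ltN) isT; exists j => //; apply: ltnW.
Qed.

(** Two moment sequences with the same distribution function agree: a monomial
    is approximated on [-B, B], within [3 * w], by a sum of ramps over the [N]
    cells of a grid, and the integral of each ramp is known up to the increment
    of [F] over its cell and a small error; these increments add up to at most
    1. *)
Lemma is_cdf_of_moments m m' K F : moment_growth K m -> moment_growth K m' ->
  0 <= K -> is_cdf_of m F -> is_cdf_of m' F -> m =1 m'.
Proof.
move=> mK m'K K0 mF m'F k; pose B := K + 1.
have B0 : 0 < B by rewrite /B; lra.
have KB : 0 <= K < B by rewrite K0 /B; lra.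
have KB1 : 0 <= K < B + 1 by rewrite K0 /B; lra.
have [L L0 Lip] := expr_lipschitz k (ltW B0).
suff bound N : (0 < N)%N -> `|m k - m' k| * N%:R <= 9 * (L * (2 * B)).
  apply/eqP; rewrite -subr_eq0 -normr_le0 leNgt; apply/negP => d0.
  have := archi_boundP (_ : 0 <= 9 * (L * (2 * B)) / `|m k - m' k|).
  rewrite divr_ge0 ?mulr_ge0 ?(ltW B0) // => /(_ isT).
  rewrite ltr_pdivrMr // mulrC; set N := Num.bound _ => NP.
  have := bound N.+1 isT; rewrite -natr1 mulrDr mulr1; lra.
move=> N0; have NR : 0 < N%:R :> R by rewrite ltr0n.
pose t i : R := - B + 2 * B * (i%:R / N%:R).
have t0 : t 0%N = - B by rewrite /t mul0r mulr0 addr0.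
have tN : t N = B by rewrite /t divff ?gt_eqF // mulr1; lra.
have tS i : t i.+1 - t i = 2 * B / N%:R.
  by rewrite /t -natr1; field; rewrite gt_eqF.
have tB i : (i <= N)%N -> `|t i| <= B.
  move=> iN; rewrite /t ler_norml.
  have i1 : 0 <= (i%:R / N%:R : R) <= 1.
    by rewrite divr_ge0 //= ler_pdivrMr // mul1r ler_nat.
  by case/andP: i1 => ? ?; apply/andP; split; nra.
pose w := L * (2 * B / N%:R).
have w0 : 0 <= w by rewrite mulr_ge0 // divr_ge0 // mulr_ge0 // ltW.
pose de : R := N%:R^-1; have de0 : 0 < de by rewrite invr_gt0.
have Nde : N%:R * de = 1 by rewrite divff ?gt_eqF.
pose c i := t i ^+ k - t i.+1 ^+ k.
have cw i : (i < N)%N -> `|c i| <= w.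
  move=> iN; apply: le_trans (Lip _ _ (tB _ (ltnW iN)) (tB _ iN)) _.
  rewrite ler_wpM2l // distrC tS ger0_norm // divr_ge0 // mulr_ge0 //; exact: ltW.
have /choice[P PP] : forall i, exists P : {poly R}, (i < N)%N ->
    forall y, `|y| <= B + 1 -> [/\ 0 <= P.[y] <= 1, y <= t i -> 1 - de <= P.[y]
      & t i.+1 <= y -> P.[y] <= de].
  move=> i; have [iN|] := ltnP i N; last by exists 0.
  have ti : `|t i| < B + 1 by apply: le_lt_trans (tB _ (ltnW iN)) _; rewrite ltrDl.
  have ti1 : `|t i.+1| < B + 1 by apply: le_lt_trans (tB _ iN) _; rewrite ltrDl.
  have tt : t i < t i.+1.
    by rewrite -subr_gt0 tS divr_gt0 // mulr_gt0.
  by have [Q QP] := ramp_poly ti ti1 tt de0; exists Q.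
pose S : {poly R} := (B ^+ k)%:P + \sum_(i < N) c i *: P i.
have SX y : `|y| <= B -> `|('X^k - S).[y]| <= 3 * w.
  move=> yB; rewrite hornerD hornerN hornerXn hornerD hornerC horner_sum.
  have [|j jN /andP[tjy ytj]] := @find_cell t y N _ N0.
    by rewrite t0 tN -ler_norml.
  have -> : B ^+ k = t j.+1 ^+ k - \sum_(i < N) c i * (j < i)%N%:R.
    under eq_bigr do rewrite mulr_natr mulrb.
    rewrite -big_mkcond /= -(big_mkord (fun i => j < i)%N c).
    rewrite (big_cat_nat _ (n := j.+1)) //= [X in _ - (X + _)]big1_seq ?add0r; last first.
      by move=> i /andP[ji]; rewrite mem_index_iota => /andP[_]; rewrite ltnS leqNgt ji.
    have -> : \sum_(j.+1 <= i < N | (j < i)%N) c i =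
        \sum_(j.+1 <= i < N) - (t i.+1 ^+ k - t i ^+ k).
      rewrite big_nat_cond [RHS]big_nat_cond.
      by apply: eq_big => i; [case: (ltnP j i); rewrite ?andbT|rewrite opprB].
    by rewrite sumrN (telescope_sumr (fun i => t i ^+ k)) // tN opprK addrC subrK.
  have -> : y ^+ k - (t j.+1 ^+ k - \sum_(i < N) c i * (j < i)%N%:R
      + \sum_(i < N) (c i *: P i).[y]) =
    (y ^+ k - t j.+1 ^+ k) - \sum_(i < N) c i * ((P i).[y] - (j < i)%N%:R).
    under [X in _ = _ - X]eq_bigr do rewrite mulrBr.
    have -> : \sum_(i < N) (c i *: P i).[y] = \sum_(i < N) c i * (P i).[y].
      by apply: eq_bigr => i _; rewrite hornerZ.
    by rewrite sumrB; ring.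
  apply: le_trans (ler_normB _ _) _.
  have -> : 3 * w = w + (w + w * (N%:R * de)) by rewrite Nde; ring.
  apply: lerD.
    apply: le_trans (Lip _ _ yB (tB _ jN)) _; rewrite ler_wpM2l //.
    rewrite distrC ger0_norm ?subr_ge0 //; have := tS j; lra.
  apply: le_trans (ler_norm_sum _ _ _) _.
  apply: le_trans (_ : \sum_(i < N) (w * (i == j :> nat)%:R + w * de) <= _).
    apply: ler_sum => i _; rewrite -mulrDr normrM.
    apply: ler_pM => //; first exact: cw.
    have yB1 : `|y| <= B + 1 by apply: le_trans yB _; rewrite lerDl.
    have [/andP[P0 P1] Pt Pt'] := PP i (ltn_ord i) y yB1.
    have mono a b : (a <= b)%N -> t a <= t b.
      by move=> ab; rewrite /t lerD2l ler_pM2l ?mulr_gt0 // ler_pM2r ?invr_gt0 // ler_nat.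
    case: (ltngtP i j) => ij /=.
    - have := Pt' (le_trans (mono _ _ ij) tjy).
      by rewrite subr0 add0r ger0_norm.
    - have := Pt (le_trans ytj (mono _ _ ij)) => ?.
      by rewrite add0r distrC ger0_norm ?subr_ge0 //; lra.
    - by rewrite subr0 ger0_norm // (le_trans P1) // lerDl ltW.
  rewrite big_split /= sumr_const card_ord -[X in _ + X <= _]mulr_natl mulrCA lerD2r.
  rewrite -mulr_sumr (bigD1 (Ordinal jN)) //= eqxx big1 ?addr0 ?mulr1 // => i.
  by rewrite -val_eqE /= => /negPf ->.
have momP (n : nat -> R) : moment_growth K n -> is_cdf_of n F -> forall i, (i < N)%N ->
    F (t i) - de <= mom n (P i) <= F (t i.+1) + de.
  move=> nK nF i iN.
  have loc y : `|y| <= B + 1 -> (y <= t i)%R%:R <= (P i + de%:P).[y] /\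
      (P i - de%:P).[y] <= (y <= t i.+1)%R%:R.
    move=> yB; have [/andP[P0 P1] Pt Pt'] := PP i iN y yB.
    rewrite !hornerD hornerN !hornerC; split.
      by case: (leP y (t i)) => [/Pt|_] /=; lra.
    by case: (leP y (t i.+1)) => [_|/ltW /Pt'] /=; lra.
  have de_cst := mom_cst de (cdf_mom0 nF).
  apply/andP; split.
    rewrite lerBlDr -[X in _ <= _ + X]de_cst -momD.
    by apply: (mom_ub_local nK KB1 nF) => y yB; apply: (loc y yB).1.
  rewrite -lerBlDr -[X in _ - X <= _]de_cst -momB.
  by apply: (mom_lb_local nK KB1 nF) => y yB; apply: (loc y yB).2.
have mS : `|mom m S - mom m' S| <= 3 * w.
  rewrite /S !momD !mom_cst ?(cdf_mom0 mF) ?(cdf_mom0 m'F) //.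
  rewrite opprD addrACA subrr add0r !mom_sum -sumrB.
  apply: le_trans (ler_norm_sum _ _ _) _.
  apply: le_trans (_ : \sum_(i < N) w * ((F (t i.+1) - F (t i)) + 2 * de) <= _).
    apply: ler_sum => i _; rewrite !momZ -mulrBr normrM ler_pM //; first exact: cw.
    have /andP[a1 a2] := momP m mK mF i (ltn_ord i).
    have /andP[b1 b2] := momP m' m'K m'F i (ltn_ord i).
    by rewrite ler_norml; apply/andP; split; lra.
  rewrite -mulr_sumr mulrC ler_wpM2r // big_split /= sumr_const card_ord.
  rewrite -(big_mkord xpredT (fun i => F (t i.+1) - F (t i))) telescope_sumr //.
  have -> : 2 * de *+ N = 2 by rewrite -mulr_natl mulrCA Nde mulr1.
  have := cdf_of_le1 (t N) mF; have := cdf_of_ge0 (t 0%N) mF; lra.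
have d1 := mom_norm_le_local mK KB mF SX.
have d2 := mom_norm_le_local m'K KB m'F SX.
rewrite !momB !momXn in d1 d2.
have -> : m k - m' k = (m k - mom m S) - (m' k - mom m' S) + (mom m S - mom m' S) by ring.
(* The constant 9: passing from the monomial to [S] costs [3 * w] for each
   sequence, and [S] itself another [3 * w]. *)
have -> : 9 * (L * (2 * B)) = (3 * w + 3 * w + 3 * w) * N%:R.
  by rewrite /w; field; rewrite gt_eqF.
rewrite ler_pM2r //; apply: le_trans (ler_normD _ _) (lerD _ mS).
exact: le_trans (ler_normB _ _) (lerD d1 d2).
Qed.
End MomentFunctional.

(** * The probability measure with given moments *)

Section ProbabilityOfMoments.
Context {R : realType}.
Implicit Types (mu nu : probability (measurableTypeR R) R) (m : nat -> R).

Lemma distribution_functionE mu x : mu `]-oo, x]%classic = (distribution_function mu x)%:E.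
Proof.
by rewrite /distribution_function -set_itvNyc fineK // fin_num_measure.
Qed.

Lemma distribution_function_right_continuous mu : right_continuous (distribution_function mu).
Proof.
have mid : measurable_fun setT (idfun : measurableTypeR R -> R) by exact: measurable_id.
pose X : {mfun measurableTypeR R >-> R} := HB.pack (idfun : measurableTypeR R -> R)
  (@isMeasurableFun.Build _ _ _ _ (idfun : measurableTypeR R -> R) mid).
have XE : distribution_function mu = fine \o cdf (X : {RV mu >-> R}).
  apply/funext => x; rewrite /distribution_function /= -set_itvNyc.
  by rewrite /cdf /distribution /pushforward.
move=> a; rewrite XE; apply: fine_cvg.
rewrite fineK; first exact: cdf_right_continuous.
by rewrite fin_num_measure.
Qed.

Lemma stieltjes_unique (f : cumulativeBounded (0 : R) (1 : R)) mu :
  (forall x, distribution_function mu x = f x) ->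
  forall A : set (measurableTypeR R), measurable A -> lebesgue_stieltjes_measure f A = mu A.
Proof.
move=> muf A mA; apply: lebesgue_stieltjes_measure_unique => [I [[a b]]/= _ <- | //].
rewrite /lebesgue_stieltjes_measure /measure_extension/=.
rewrite measurable_mu_extE/=; last exact: is_ocitv.
have [ab | ba] := leP a b; last first.
  by rewrite set_itv_ge ?wlength0 ?measure0// bnd_simp -leNgt ltW.
rewrite wlength_itv_bnd// EFinB -!muf -!distribution_functionE.
have -> : `]a, b]%classic = `]-oo, b]%classic `\` `]-oo, a]%classic.
  by rewrite -[RHS]setCK setCD setCitvl setUC -[LHS]setCK setCitv.
rewrite measureD ?setIidr//; first exact: subset_itvl.
by rewrite -ge0_fin_numE// fin_num_measure.
Qed.

Section Moments.
Variables (mu : probability (measurableTypeR R) R) (m : nat -> R).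
Hypothesis mu_m : forall k, has_moment mu k (m k).

Let int_poly (p : {poly R}) : mu.-integrable setT (fun x : R => (p.[x])%:E) /\
  (\int[mu]_x (p.[x])%:E = (mom m p)%:E)%E.
Proof.
have pE : (fun x : R => (p.[x])%:E) =
   (fun x : R => (\sum_(i < size p) (p`_i)%:E * (x ^+ i)%:E)%E).
  by apply/funext => x; rewrite horner_coef -sumEFin.
have intZ (i : 'I_(size p)) : mu.-integrable setT (fun x : R => ((p`_i)%:E * (x ^+ i)%:E)%E).
  by apply: integrableZl => //; exact: (mu_m i).1.
split; first by rewrite pE; exact: integrable_sum.
rewrite pE integral_sum // /mom -sumEFin; apply: eq_bigr => i _.
rewrite integralZl //; last exact: (mu_m i).1.
by rewrite (mu_m i).2.
Qed.

Lemma probability_is_cdf_of : is_cdf_of m (distribution_function mu).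
Proof.
have int_ind x : mu.-integrable setT (fun y : R => ((y <= x)%R%:R)%:E) /\
   (\int[mu]_y ((y <= x)%R%:R : R)%:E = (distribution_function mu x)%:E)%E.
  have -> : (fun y : R => ((y <= x)%R%:R : R)%:E) = EFin \o \1_(`]-oo, x]%classic).
    apply/funext => y /=; rewrite indicE; congr (_%:R%:E).
    by rewrite mem_setE in_itv.
  split; last by rewrite integral_indic // setIT -distribution_functionE.
  exact: (@integrable_indic _ (measurableTypeR R) R mu `]-oo, x]%classic).
split.
- have [_] := mu_m 0; under eq_integral do rewrite expr0.
  rewrite integral_cst // [X in (_ * X)%E](_ : _ = 1%E); last exact: probability_setT.
  by rewrite mule1 => -[].
- move=> p p0; rewrite -lee_fin -(int_poly p).2; apply: integral_ge0 => x _.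
  by rewrite lee_fin.
- move=> p x px; rewrite -lee_fin -(int_poly p).2 -(int_ind x).2.
  apply: le_integral => //; [exact: (int_ind x).1|exact: (int_poly p).1|].
  by move=> y _; rewrite lee_fin.
- move=> p x px; rewrite -lee_fin -(int_poly p).2 -(int_ind x).2.
  apply: le_integral => //; [exact: (int_poly p).1|exact: (int_ind x).1|].
  by move=> y _; rewrite lee_fin.
Qed.
End Moments.

Lemma bounded_support_moments mu B : 0 <= B -> mu (~` `[- B, B]%classic) = 0%E ->
  exists2 m, forall k, has_moment mu k (m k) & moment_growth B m.
Proof.
move=> B0 supp.
have mB : measurable (`[- B, B]%classic : set (measurableTypeR R)) by [].
have mC : measurable (~` `[- B, B]%classic : set (measurableTypeR R)) by exact: measurableC.
have mX k : measurable_fun setT (fun x : R => (x ^+ k)%:E).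
  by apply/measurable_EFinP; exact: exprn_measurable.
have intX k : mu.-integrable setT (fun x : R => (x ^+ k)%:E).
  apply: (negligible_integrable mC measurableT (mX k) supp).2.
  rewrite setTD setCK.
  apply: measurable_bounded_integrable => //.
  - by rewrite -ge0_fin_numE // fin_num_measure.
  - exists (B ^+ k); split; first by rewrite num_real.
    move=> M BM x /=; rewrite in_itv /= -ler_norml => xB.
    by rewrite normrX (le_trans _ (ltW BM)) // lerXn2r ?nnegrE.
exists (fun k => fine (\int[mu]_x (x ^+ k)%:E)%E) => [k|j].
  by split => //; rewrite fineK // integrable_fin_num.
rewrite (negligible_integral mC measurableT (intX _) supp) setTD setCK.
rewrite -lee_fin fineK; last first.
  by apply: integrable_fin_num => //; apply: integrableS (intX _).
apply: (@le_trans _ _ (\int[mu]_(x in `[(- B)%R, B]) (B ^+ j.*2)%:E)%E).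
  apply: ge0_le_integral => //.
  - by move=> x _; rewrite lee_fin exprn_even_ge0 // odd_double.
  - exact: (measurable_funTS (mX _)).
  - move=> x /=; rewrite in_itv /= -ler_norml => xB; rewrite lee_fin.
    by rewrite -[leLHS](@ger0_norm R) ?exprn_even_ge0 ?odd_double // normrX lerXn2r ?nnegrE.
rewrite integral_cst // -[leRHS]mule1.
by apply: lee_wpmul2l; rewrite ?lee_fin ?exprn_ge0 // probability_le1.
Qed.

(** The measure is the Stieltjes measure of the dual distribution function.
    Majorants only matter on a bounded interval, so it is supported there and
    has some moments; these are [m] because they share the distribution
    function with [m]. *)
Theorem probability_of_moments m K : moment_growth K m -> 0 <= K -> m 0 = 1 ->
  (forall p : {poly R}, (forall y, 0 <= p.[y]) -> 0 <= mom m p) ->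
  exists mu, [/\ distribution_function mu = dual_cdf m,
    forall k, has_moment mu k (m k) & determined_by_moments mu].
Proof.
move=> mK K0 m0 m_ge0; set F := dual_cdf m.
have mF : is_cdf_of m F by exact: dual_cdf_is_cdf_of.
pose f : cumulativeBounded (0 : R) (1 : R) := HB.pack F
  (isCumulative.Build R _ R F (dual_cdf_nondecreasing m_ge0)
     (dual_cdf_right_continuous m0 m_ge0))
  (isCumulativeBounded.Build R 0 1 F (cdf_cvgNy mF) (cdf_cvgy mF)).
pose mu : probability (measurableTypeR R) R := lebesgue_stieltjes_measure f.
have muF : distribution_function mu = F.
  apply/funext => x; rewrite /distribution_function -set_itvNyc.
  have := cdf_lebesgue_stieltjes_id f x; rewrite /cdf /distribution /pushforward.
  by rewrite preimage_id => ->.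
pose B := K + 1; have KB : 0 <= K < B by rewrite K0 /B; lra.
have B0 : 0 <= B by rewrite /B; lra.
have F0 x : x < - B -> F x = 0.
  move=> xB; apply/le_anti; rewrite (cdf_of_ge0 _ mF) andbT.
  rewrite -(mom_cst 0 m0); apply: (mom_ub_local mK KB mF) => y.
  rewrite ler_norml => /andP[By _]; rewrite hornerC.
  by case: (leP y x) => //= yx; move: (le_lt_trans yx xB); lra.
have F1 : F B = 1.
  apply/le_anti; rewrite (cdf_of_le1 _ mF) /=.
  rewrite -(mom_cst 1 m0); apply: (mom_lb_local mK KB mF) => y.
  by rewrite ler_norml hornerC => /andP[_ ->].
have supp : mu (~` `[- (B + 1), B + 1]%classic) = 0%E.
  apply/eqP; rewrite -measure_le0.
  have -> : ~` `[- (B + 1), B + 1]%classic = `]-oo, - (B + 1)[%classic `|` `]B + 1, +oo[%classic.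
    by rewrite setCitv.
  apply: le_trans (measureU2 _ _ _) _ => //.
  apply: (@le_trans _ _ (mu `]-oo, (- (B + 1))%R]%classic + mu (~` `]-oo, B]%classic)))%E.
    apply: leeD; apply: le_measure; rewrite ?inE //.
    - by apply: subset_itvl; rewrite bnd_simp.
    - exact: measurableC.
    - by rewrite setCitvl; apply: subset_itvr; rewrite bnd_simp lerDl.
  rewrite probability_setC // !distribution_functionE muF F1 F0 ?add0e ?subee //.
  by rewrite ltrN2 ltrDl.
have [m' mu_m' m'K] := bounded_support_moments (addr_ge0 B0 ler01) supp.
have m'F : is_cdf_of m' F by rewrite -muF; exact: probability_is_cdf_of.
have K01 : 0 <= B + 1 by rewrite addr_ge0.
have mK' : moment_growth (B + 1) m.
  move=> j; apply: le_trans (mK j) _; rewrite lerXn2r ?nnegrE //.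
  by rewrite /B; lra.
have mm' := is_cdf_of_moments mK' m'K K01 mF m'F.
have mu_m k : has_moment mu k (m k) by rewrite mm'.
exists mu; split => //; exists m => // nu nu_m A mA.
have nuF := probability_is_cdf_of nu_m.
apply/esym; apply: (stieltjes_unique (f := f)) => // x; apply/le_anti/andP; split.
  exact: is_cdf_of_unique mK K0 nuF mF (dual_cdf_right_continuous m0 m_ge0) x.
exact: is_cdf_of_unique mK K0 mF nuF (@distribution_function_right_continuous nu) x.
Qed.

End ProbabilityOfMoments.

(** * Eigenvalues of real symmetric matrices *)

Section RealSymmetric.
Local Open Scope sesquilinear_scope.
Local Notation cplx := (real_complex _).

Lemma sym_unitary_diag {R : rcfType} n (A : 'M[R]_n) : A^T = A ->
  exists U : 'M[R[i]]_n, exists d : 'rV[R]_n,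
    U \is unitarymx /\ map_mx cplx A = U^t* *m diag_mx (map_mx cplx d) *m U.
Proof.
move=> symA; set A' := map_mx cplx A.
have A'real : A' \is a realmx.
  apply/mxOverP => i j; rewrite mxE.
  by rewrite complex_real.
have A'sym : A' \is symmetricmx.
  by apply/is_hermitianmxP; rewrite expr0 scale1r map_mx_id // /A' map_trmx symA.
have A'h := realsym_hermsym A'sym A'real.
have /hermitian_normalmx /orthomx_spectralP A_eq := A'h.
have dr := hermitian_spectral_diag_real A'h.
exists (spectralmx A'); exists (map_mx (@complex.Re _) (spectral_diag A')); split.
  exact: spectral_unitarymx.
rewrite {1}A_eq (invmx_unitary (spectral_unitarymx A')).
congr (_ *m diag_mx _ *m _).
apply/matrixP => i j; rewrite !mxE RRe_real //; exact: (mxOverP dr).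
Qed.

(** Counting the occurrences of each value compares the list of roots with
    multiplicities to the factors of the characteristic polynomial. *)
Lemma perm_eigenvalues {R : realType} n (A : 'M[R]_n) (d : 'rV[R]_n) :
  char_poly A = \prod_(i < n) ('X - (d 0 i)%:P) ->
  perm_eq (eigenvalues A) [seq d 0 i | i <- enum 'I_n].
Proof.
move=> chA; have ch0 : char_poly A != 0 by exact/monic_neq0/char_poly_monic.
have mupE l : mup l (char_poly A) = count (pred1 l) [seq d 0 i | i <- enum 'I_n].
  rewrite chA -(big_enum _ _ _ (fun i => 'X - (d 0 i)%:P)) /=.
  elim: (enum _) => [|i s IH] /=.
    by rewrite big_nil mupNroot // /root hornerC oner_eq0.
  rewrite big_cons mupM ?polyXsubC_eq0 //; last first.
    by rewrite prodf_seq_neq0; apply/allP => j _; rewrite polyXsubC_eq0.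
  by rewrite IH; congr (_ + _)%N; rewrite -['X - _]expr1 mup_XsubCX eq_sym; case: eqP.
rewrite /perm_eq; apply/allP => l _ /=; rewrite -[X in _ == X]mupE; apply/eqP.
rewrite /eigenvalues count_flatten -map_comp.
have memr x : (x \in rootsR (char_poly A)) = root (char_poly A) x.
  by rewrite -(roots_on_rootsR ch0).
have un : uniq (rootsR (char_poly A)) by exact: uniq_roots.
rewrite (eq_map (g := fun x => if x == l then mup l (char_poly A) else 0%N)); last first.
  by move=> x /=; rewrite count_nseq /=; case: eqP => [->|_]; rewrite ?mul1n ?mul0n.
rewrite sumnE big_map -big_mkcond /= big_const_seq iter_addn_0.
rewrite (count_uniq_mem _ un) memr; case: (boolP (root _ _)) => [_|/mupNroot->].
  by rewrite muln1.
by [].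
Qed.

Lemma eigenvalues_sym {R : realType} n (A : 'M[R]_n) : A^T = A ->
  exists U : 'M[R[i]]_n, exists d : 'rV[R]_n,
    [/\ U \is unitarymx, map_mx cplx A = U^t* *m diag_mx (map_mx cplx d) *m U
      & perm_eq (eigenvalues A) [seq d 0 i | i <- enum 'I_n]].
Proof.
move=> /sym_unitary_diag[U [d [uU AE]]]; exists U, d; split => //.
apply: perm_eigenvalues.
apply: (@map_poly_inj _ _ cplx); rewrite map_char_poly AE.
have Uu := unitarymx_unit uU.
have -> : char_poly (U ^t* *m diag_mx (map_mx cplx d) *m U)
  = char_poly (diag_mx (map_mx cplx d)).
  rewrite -(invmx_unitary uU).
  apply/esym; rewrite /char_poly.
  have -> : char_poly_mx (invmx U *m diag_mx (map_mx cplx d) *m U) =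
     map_mx polyC (invmx U) *m char_poly_mx (diag_mx (map_mx cplx d)) *m map_mx polyC U.
    rewrite /char_poly_mx mulmxBr mulmxBl !map_mxM; congr (_ - _).
    by rewrite scalar_mxC -mulmxA -map_mxM mulVmx // map_mx1 mulmx1.
  rewrite !det_mulmx mulrAC -det_mulmx -map_mxM mulVmx // map_mx1 det1 mul1r //.
rewrite char_poly_trig ?diag_mx_is_trig // rmorph_prod.
apply: eq_bigr => i _; rewrite !mxE eqxx mulr1n.
by rewrite rmorphB /= map_polyX map_polyC.
Qed.

Lemma sum_eigenvalues_pow {R : realType} n (A : 'M[R]_n) k : A^T = A ->
  \sum_(l <- eigenvalues A) l ^+ k = \tr (A ^+ k).
Proof.
move=> /eigenvalues_sym[U [d [uU AE pd]]].
rewrite (perm_big _ pd) /= big_map big_enum /=.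
apply: (@complexI R); rewrite -[RHS]trace_map_mx rmorphXn /= AE -(invmx_unitary uU).
have Uu := unitarymx_unit uU.
have -> : (invmx U *m diag_mx (map_mx cplx d) *m U) ^+ k =
    invmx U *m (diag_mx (map_mx cplx d)) ^+ k *m U.
  elim: k => [|k IH]; first by rewrite !expr0 mulmx1 mulVmx.
  by rewrite !exprS IH -!mulmxE !mulmxA mulmxK.
rewrite mxtrace_mulC mulmxA mulmxV // mul1mx.
have -> : diag_mx (map_mx cplx d) ^+ k = diag_mx (\row_i cplx (d 0 i ^+ k)).
  elim: k => [|k IH].
    rewrite expr0; apply/matrixP => i j; rewrite !mxE expr0 rmorph1.
    by [].
  rewrite exprS IH -mulmxE mulmx_diag; congr diag_mx.
  by apply/rowP => i; rewrite !mxE -rmorphM exprS.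
rewrite mxtrace_diag rmorph_sum; apply: eq_bigr => i _; by rewrite !mxE.
Qed.

Lemma rank_diag_le {F : fieldType} n (d : 'rV[F]_n) :
  (\rank (diag_mx d) <= #|[pred i | d 0%R i != 0%R]|)%N.
Proof.
have -> : diag_mx d = \sum_(i | d 0 i != 0) d 0 i *: delta_mx i i.
  rewrite diag_mx_sum_delta [RHS]big_mkcond /=; apply: eq_bigr => i _.
  by case: eqP => [->|]; rewrite ?scale0r.
rewrite -sum1_card.
apply: (big_ind2 (fun (M : 'M[F]_n) k => (\rank M <= k)%N)).
- by rewrite mxrank0.
- move=> M k N l Mk Nl; exact: leq_trans (mxrank_add _ _) (leq_add Mk Nl).
- by move=> i _; rewrite (leq_trans (mxrank_scale _ _)) // mxrank_delta.
Qed.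

(** A nonzero vector in the span of the eigenvectors of [A] below [x], in the
    span of those of [B] above [x], and in the kernel of [A - B] would have
    its two equal quadratic forms on different sides of [x]; so the three
    codimensions add up to at least [n]. *)
Lemma count_eigenvalues_rank {R : realType} n (A B : 'M[R]_n) (x : R) :
  A^T = A -> B^T = B ->
  (count (fun l => (l <= x)%R) (eigenvalues A) <=
   count (fun l => (l <= x)%R) (eigenvalues B) + \rank (A - B)%R)%N.
Proof.
move=> /eigenvalues_sym[U [d [uU AE pd]]] /eigenvalues_sym[V [e [uV BE pe]]].
rewrite (permP pd) (permP pe).
have countE (f : 'rV[R]_n) : count (fun l => (l <= x)%R) [seq f 0 i | i <- enum 'I_n]
    = #|[pred i | (f 0 i <= x)%R]|.
  by rewrite -sum1_card -sum1_count big_map big_enum_cond; apply: eq_bigl.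
rewrite !countE leqNgt; apply/negP => lt.
pose D1 := diag_mx (\row_i (x < d 0 i)%R%:R : 'rV[R[i]]_n).
pose D2 := diag_mx (\row_i (e 0 i <= x)%R%:R : 'rV[R[i]]_n).
(* A row vector kills the three blocks of [M] when it has no component on the
   eigenvectors of [A] above [x], is killed by [A - B], and has no component on
   the eigenvectors of [B] below [x]. *)
pose M := row_mx (U^t* *m D1) (row_mx (map_mx cplx (A - B)) (V^t* *m D2)).
have rM : (\rank M < n)%N.
  have r1 : (\rank (U^t* *m D1) <= n - #|[pred i | (d 0 i <= x)%R]|)%N.
    apply: leq_trans (mxrankM_maxr _ _) _; apply: leq_trans (rank_diag_le _) _.
    rewrite -[X in (_ <= X - _)%N]card_ord -(cardC [pred i | (d 0 i <= x)%R]) addKn.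
    apply/subset_leq_card/fintype.subsetP => i.
    by rewrite !inE !mxE ltNge; case: (_ <= _); rewrite //= eqxx.
  have r2 : (\rank (V^t* *m D2) <= #|[pred i | (e 0 i <= x)%R]|)%N.
    apply: leq_trans (mxrankM_maxr _ _) _; apply: leq_trans (rank_diag_le _) _.
    apply/subset_leq_card/fintype.subsetP => i.
    by rewrite !inE !mxE; case: (_ <= _); rewrite //= eqxx.
  have cd : (#|[pred i | (d 0 i <= x)%R]| <= n)%N by rewrite -[leqRHS]card_ord max_card.
  have rk (a b c : nat) (X : 'M[R[i]]_(a, b)) (Y : 'M[R[i]]_(a, c)) :
     (\rank (row_mx X Y) <= \rank X + \rank Y)%N.
    rewrite -mxrank_tr tr_row_mx -(mxrank_tr X) -(mxrank_tr Y).
    by rewrite -addsmxE mxrank_adds_leqif.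
  apply: leq_ltn_trans (rk _ _ _ _ _) _.
  apply: leq_ltn_trans (leq_add r1 (rk _ _ _ _ _)) _.
  rewrite mxrank_map.
  apply: leq_ltn_trans (leq_add (leqnn _) (leq_add (leqnn _) r2)) _.
  rewrite addnC [X in (X + _)%N]addnC; move: lt cd; clear.
  move: #|_| #|_| (\rank _) => a b c ??; lia.
have /rowV0Pn[v vM v0] : kermx M != 0.
  by rewrite -mxrank_eq0 mxrank_ker -lt0n subn_gt0.
move/sub_kermxP: vM; rewrite /M !mul_mx_row => vM.
have vM' : row_mx (v *m (U ^t* *m D1)) (row_mx (v *m map_mx cplx (A - B)) (v *m (V ^t* *m D2))) 
   = row_mx 0 (row_mx 0 0) by rewrite vM !row_mx0.
have [v1 /eq_row_mx [v2 v3]] := eq_row_mx vM'.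
pose a := v *m U^t*; pose b := v *m V^t*.
have a0 i : x < d 0 i -> a 0 i = 0.
  move=> xd; move/matrixP: v1 => /(_ 0 i); rewrite mulmxA -/a /D1 mul_mx_diag !mxE.
  by rewrite xd mulr1 => ->.
have b0 i : e 0 i <= x -> b 0 i = 0.
  move=> xd; move/matrixP: v3 => /(_ 0 i); rewrite mulmxA -/b /D2 mul_mx_diag !mxE.
  by rewrite xd mulr1 => ->.
have qf (W : 'M[R[i]]_n) (f : 'rV[R]_n) : W \is unitarymx ->
   (v *m (W^t* *m diag_mx (map_mx cplx f) *m W) *m v^t*) 0 0 = 
   \sum_i cplx (f 0 i) * `|(v *m W^t*) 0 i| ^+ 2.
  move=> uW; rewrite !mulmxA -mulmxA.
  have -> : W *m v^t* = (v *m W^t*)^t* by rewrite trmx_mul map_mxM trmxCK.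
  rewrite mul_mx_diag [LHS]mxE; apply: eq_bigr => i _; rewrite !mxE.
  by rewrite mulrAC normCK mulrC.
have nf (W : 'M[R[i]]_n) : W \is unitarymx ->
   (v *m v^t*) 0 0 = \sum_i `|(v *m W^t*) 0 i| ^+ 2.
  move=> uW; have -> : v *m v^t* = (v *m W^t*) *m (v *m W^t*)^t*.
    by rewrite trmx_mul map_mxM trmxCK !mulmxA mulmxKtV.
  by rewrite mxE; apply: eq_bigr => i _; rewrite !mxE normCK.
have eqf : (v *m map_mx cplx A *m v^t*) 0 0 = (v *m map_mx cplx B *m v^t*) 0 0.
  suff -> : v *m map_mx cplx A = v *m map_mx cplx B by [].
  by apply/eqP; rewrite -subr_eq0 -mulmxBr -map_mxB v2.
have le1 : (v *m map_mx cplx A *m v^t*) 0 0 <= cplx x * (v *m v^t*) 0 0.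
  rewrite AE (qf _ _ uU) (nf _ uU) mulr_sumr; apply: ler_sum => i _.
  have [xd|dx] := ltP x (d 0 i); first by rewrite a0 // normr0 expr0n !mulr0.
  by rewrite ler_wpM2r ?exprn_ge0 // lecR.
have ge0 i : 0 <= (cplx (e 0 i) - cplx x) * `|b 0 i| ^+ 2.
  have [xe|ex] := ltP x (e 0 i); last by rewrite b0 // normr0 expr0n mulr0.
  by rewrite mulr_ge0 ?exprn_ge0 // subr_ge0 lecR ltW.
have sum0 : \sum_i (cplx (e 0 i) - cplx x) * `|b 0 i| ^+ 2 = 0.
  apply/le_anti/andP; split; last exact/sumr_ge0.
  under eq_bigr do rewrite mulrBl.
  by rewrite sumrB -mulr_sumr -(nf _ uV) -(qf _ _ uV) -BE -eqf subr_le0.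
have b_0 : b = 0.
  apply/rowP => i; rewrite [RHS]mxE; apply/eqP.
  have [xe|ex] := ltP x (e 0 i); last by rewrite b0.
  have /eqP : (cplx (e 0 i) - cplx x) * `|b 0 i| ^+ 2 = 0.
    by apply: (psumr_eq0P (fun i _ => ge0 i) sum0).
  rewrite mulf_eq0 subr_eq0 expf_eq0 /= normr_eq0 => /orP[|//].
  by rewrite (inj_eq (@complexI R)) gt_eqF.
by move/eqP: v0; apply; rewrite -(mulmxKtV v uV) // -/b b_0 mul0mx.
Qed.

(** The cross is one row, plus what remains of one column. *)
Lemma rank_cross_le {F : fieldType} n (C : 'M[F]_n) (i : 'I_n) :
  (forall k l, k != i -> l != i -> C k l = 0) -> (\rank C <= 2)%N.
Proof.
move=> C0.
have -> : C = delta_mx i (0 : 'I_1) *m row i C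
    + (\col_k (if k == i then 0 else C k i)) *m delta_mx (0 : 'I_1) i.
  apply/matrixP => k l; rewrite !mxE !big_ord1 !mxE !eqxx /=.
  case: (eqVneq k i) => [->|ki] /=; first by rewrite mul1r mul0r addr0.
  case: (eqVneq l i) => [->|li] /=; first by rewrite mul0r add0r mulr1.
  by rewrite mul0r mulr0 addr0 C0.
apply: leq_trans (mxrank_add _ _) _; rewrite -[2%N]/(1 + 1)%N leq_add //.
  exact: leq_trans (mxrankM_maxl _ _) (rank_leq_col _).
exact: leq_trans (mxrankM_maxl _ _) (rank_leq_col _).
Qed.

(** Changing one row and the same column of a symmetric matrix is a
    perturbation of rank at most 2. *)
Lemma esd_cross_change {R : realType} n (A B : 'M[R]_n) (i : 'I_n) (x : R) :
  A^T = A -> B^T = B -> (forall k l, k != i -> l != i -> A k l = B k l) ->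
  `|esd A x - esd B x| <= 2 / n%:R.
Proof.
move=> sA sB AB.
have n0 : (0 < n)%N by apply: leq_ltn_trans (ltn_ord i).
have r C D : C^T = C -> D^T = D -> (forall k l, k != i -> l != i -> C k l = D k l) ->
    esd C x - esd D x <= 2 / n%:R.
  move=> sC sD CD; rewrite /esd -mulrBr mulrC ler_wpM2r ?invr_ge0 //.
  rewrite lerBlDl -natrD ler_nat.
  apply: leq_trans (count_eigenvalues_rank _ sC sD) _.
  rewrite leq_add2l; apply: (@rank_cross_le _ _ _ i) => k l ki li.
  by rewrite !mxE CD // subrr.
by rewrite ler_norml lerNl opprB !r // => k l ki li; rewrite AB.
Qed.

Lemma sum_le_esd {R : realType} n (A : 'M[R]_n) (x : R) :
  esd A x = n%:R^-1 * \sum_(l <- eigenvalues A) (l <= x)%R%:R.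
Proof.
rewrite /esd -sum1_count natr_sum big_mkcond; congr (_ * _).
by apply: eq_bigr => l _; case: (l <= x).
Qed.

End RealSymmetric.

(** * Concentration for independent bits *)

Section ProductBernoulli.
Context {R : realFieldType} {I : finType}.
Variable p : I -> R.
Implicit Types (s t : {ffun I -> bool}) (f g : {ffun I -> bool} -> R).

(** The law of independent bits, the bit [k] being set with probability [p k]. *)
Definition bern_weight s : R := \prod_k (if s k then p k else 1 - p k).
Definition bern_exp f : R := \sum_s bern_weight s * f s.

Lemma eq_bern_exp f g : f =1 g -> bern_exp f = bern_exp g.
Proof. by move=> fg; apply: eq_bigr => s _; rewrite fg. Qed.

Lemma bern_expD f g : bern_exp (fun s => f s + g s) = bern_exp f + bern_exp g.
Proof. by rewrite -big_split; apply: eq_bigr => s _; rewrite mulrDr. Qed.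

Lemma bern_expZ c f : bern_exp (fun s => c * f s) = c * bern_exp f.
Proof. by rewrite mulr_sumr; apply: eq_bigr => s _; rewrite mulrCA. Qed.

Lemma bern_expB f g : bern_exp (fun s => f s - g s) = bern_exp f - bern_exp g.
Proof. by rewrite -sumrB; apply: eq_bigr => s _; rewrite mulrBr. Qed.

Lemma bern_exp_sum (J : Type) (r : seq J) (F : J -> {ffun I -> bool} -> R) :
  bern_exp (fun s => \sum_(j <- r) F j s) = \sum_(j <- r) bern_exp (F j).
Proof. by rewrite exchange_big; apply: eq_bigr => s _; rewrite mulr_sumr. Qed.

(** A bit is idempotent, so a repeated factor counts once. *)
Lemma bern_exp_prod (r : seq I) :
  bern_exp (fun s => \prod_(k <- r) (s k)%:R) = \prod_(k <- undup r) p k.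
Proof.
pose F k (b : bool) : R :=
  (if b then p k else 1 - p k) * (if k \in r then b%:R else 1).
have Fb s : bern_weight s * \prod_(k <- r) (s k)%:R = \prod_k F k (s k).
  rewrite /F big_split /=; congr (_ * _); rewrite -big_mkcond /=.
  have [/allP r1|/allPn[k kr sk]] := boolP (all s r).
    by rewrite [RHS]big1 ?big1_seq // => k kr; rewrite r1.
  rewrite (big_rem _ kr) /= (negPf sk) mul0r (bigD1 k) //=.
  by rewrite (negPf sk) mul0r.
rewrite /bern_exp (eq_bigr _ (fun s _ => Fb s)) -bigA_distr_bigA /=.
rewrite [RHS]big_uniq ?undup_uniq //= [RHS]big_mkcond /=; apply: eq_bigr => k _.
rewrite big_bool /F mem_undup; case: (k \in r); rewrite !mulr1 ?mulr0.
  exact: addr0.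
by rewrite -[LHS]/(p k + (1 - p k)) addrC subrK.
Qed.

Lemma bern_exp_cst c : bern_exp (fun=> c) = c.
Proof.
have := bern_exp_prod [::]; rewrite big_nil => E1.
rewrite -[RHS]mulr1 -[X in _ = _ * X]E1 -bern_expZ.
by apply: eq_bern_exp => s; rewrite big_nil mulr1.
Qed.

Definition swap_on (S : pred I) s t : {ffun I -> bool} :=
  [ffun k => if S k then t k else s k].

(** Exchanging coordinates between two independent copies preserves their
    joint law. *)
Lemma bern_exp_swap (S : pred I) (F : {ffun I -> bool} -> {ffun I -> bool} -> R) :
  bern_exp (fun s => bern_exp (F s)) =
  bern_exp (fun s => bern_exp (fun t => F (swap_on S s t) (swap_on S t s))).
Proof.
rewrite /bern_exp.
under eq_bigr do rewrite mulr_sumr. under [RHS]eq_bigr do rewrite mulr_sumr.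
rewrite !pair_big /=.
pose h (u : {ffun I -> bool} * {ffun I -> bool}) := (swap_on S u.1 u.2, swap_on S u.2 u.1).
rewrite (reindex_inj (h := h)); last first.
  by apply: inv_inj => -[s t]; rewrite /h /=; congr pair; apply/ffunP => k;
    rewrite !ffunE; case: (S k).
apply: eq_bigr => -[s t] _ /=; rewrite !mulrA; congr (_ * _).
rewrite /bern_weight -!big_split /=; apply: eq_bigr => k _; rewrite !ffunE.
by case: (S k) => //; rewrite mulrC.
Qed.

Hypothesis p01 : forall k, 0 <= p k <= 1.

Lemma bern_weight_ge0 s : 0 <= bern_weight s.
Proof.
apply: prodr_ge0 => k _; have /andP[] := p01 k.
by case: (s k) => //; rewrite subr_ge0.
Qed.

Lemma ler_bern_exp f g : (forall s, f s <= g s) -> bern_exp f <= bern_exp g.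
Proof. by move=> fg; apply: ler_sum => s _; rewrite ler_wpM2l ?bern_weight_ge0. Qed.

Lemma bern_exp_norm_le f c : (forall s, `|f s| <= c) -> `|bern_exp f| <= c.
Proof.
move=> fc; rewrite ler_norml; apply/andP; split.
  rewrite -[leLHS]bern_exp_cst; apply: ler_bern_exp => s.
  by have := fc s; rewrite ler_norml => /andP[].
rewrite -[leRHS]bern_exp_cst; apply: ler_bern_exp => s.
by have := fc s; rewrite ler_norml => /andP[].
Qed.

(** Markov's inequality at the fourth moment. *)
Lemma bern_markov4 f m e : 0 < e ->
  bern_exp (fun s => (e <= `|f s - m|)%R%:R) <= bern_exp (fun s => (f s - m) ^+ 4) / e ^+ 4.
Proof.
move=> e0; rewrite mulrC -bern_expZ; apply: ler_bern_exp => s.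
have x40 : 0 <= (f s - m) ^+ 4 by rewrite exprn_even_ge0.
case: (leP e _) => [eh|_]; last by rewrite mulr_ge0 // invr_ge0 exprn_ge0 // ltW.
rewrite mulrC ler_pdivlMr ?exprn_gt0 // mul1r.
by rewrite -[leRHS](@ger0_norm R) // normrX lerXn2r ?nnegrE // ltW.
Qed.

Section BoundedDifferences.
Variables (b : I -> nat) (n : nat) (f : {ffun I -> bool} -> R) (c : R).
Hypothesis bn : forall k, (b k < n)%N.
Hypothesis c0 : 0 <= c.
Hypothesis fc : forall m s t, (forall k, b k != m -> s k = t k) -> `|f s - f t| <= c.

(** The martingale that exposes the blocks of coordinates one by one: the
    blocks from [m] on are averaged out. *)
Let g m s := bern_exp (fun t => f (swap_on (fun k => (m <= b k)%N) s t)).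

Let adapted m (h : {ffun I -> bool} -> R) :=
  forall s t, (forall k, (b k < m)%N -> s k = t k) -> h s = h t.

Let g_adapted m : adapted m (g m).
Proof.
move=> s t st; apply: eq_bern_exp => u; congr f; apply/ffunP => k.
by rewrite !ffunE leqNgt; case: ltnP => //= km; rewrite st.
Qed.

(* The average that defines [g m.+1] becomes the one that defines [g m] when the
   block [m] is exchanged between the two copies, which [h] does not see. *)
Let g_orth m h : adapted m h ->
  bern_exp (fun s => h s * (g m.+1 s - g m s)) = 0.
Proof.
move=> hm; under eq_bern_exp do rewrite mulrBr.
rewrite bern_expB; apply/eqP; rewrite subr_eq0; apply/eqP.
under eq_bern_exp do rewrite -bern_expZ.
under [RHS]eq_bern_exp do rewrite -bern_expZ.
rewrite (bern_exp_swap (fun k => b k == m)).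
apply: eq_bern_exp => s; apply: eq_bern_exp => t; congr (_ * f _).
  by apply: hm => k km; rewrite ffunE ltn_eqF.
by apply/ffunP => k; rewrite !ffunE; case: (ltngtP m (b k)).
Qed.

Let g_diff m s : `|g m.+1 s - g m s| <= c.
Proof.
rewrite /g -bern_expB; apply: bern_exp_norm_le => t; apply: (@fc m) => k km.
by rewrite !ffunE [(m <= b k)%N]leq_eqVlt eq_sym (negPf km).
Qed.

Let var_le m : bern_exp (fun s => (g m s - g 0 s) ^+ 2) <= m%:R * c ^+ 2.
Proof.
elim: m => [|m IH].
  by under eq_bern_exp do rewrite subrr expr0n; rewrite bern_exp_cst mul0r.
have -> : bern_exp (fun s => (g m.+1 s - g 0 s) ^+ 2) =
  bern_exp (fun s => (g m s - g 0 s) ^+ 2) +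
  bern_exp (fun s => (g m.+1 s - g m s) ^+ 2).
  rewrite -[RHS]addr0 -(mulr0 (2 : R)) -(@g_orth m (fun s => g m s - g 0 s)); last first.
    by move=> s t st; congr (_ - _); apply: g_adapted => // k; rewrite ltn0.
  by rewrite -bern_expZ -!bern_expD; apply: eq_bern_exp => s; ring.
rewrite -natr1 mulrDl mul1r lerD //.
rewrite -[leRHS]bern_exp_cst; apply: ler_bern_exp => s.
by rewrite -[leLHS](@ger0_norm R) ?exprn_even_ge0 // normrX lerXn2r ?nnegrE.
Qed.

Let fourth_le m : bern_exp (fun s => (g m s - g 0 s) ^+ 4) <= 4 * m%:R ^+ 2 * c ^+ 4.
Proof.
elim: m => [|m IH].
  by under eq_bern_exp do rewrite subrr expr0n; rewrite bern_exp_cst expr0n !mulr0 mul0r.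
pose x s := g m s - g 0 s; pose d s := g m.+1 s - g m s.
have x3 : bern_exp (fun s => x s ^+ 3 * d s) = 0.
  apply: g_orth => s t st; rewrite /x (@g_adapted m s t) // (@g_adapted 0 s t) //.
have : bern_exp (fun s => (g m.+1 s - g 0 s) ^+ 4) <=
   bern_exp (fun s => x s ^+ 4) + 4 * bern_exp (fun s => x s ^+ 3 * d s)
   + 8 * c ^+ 2 * bern_exp (fun s => x s ^+ 2) + 3 * c ^+ 4.
  rewrite -[X in _ + X](bern_exp_cst (3 * c ^+ 4)) -!bern_expZ -!bern_expD.
  apply: ler_bern_exp => s.
  have -> : g m.+1 s - g 0 s = x s + d s by rewrite /x /d; ring.
  have dc : `|d s| <= c by exact: g_diff.
  have d2 : d s ^+ 2 <= c ^+ 2.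
    by rewrite -[leLHS](@ger0_norm R) ?exprn_even_ge0 // normrX lerXn2r ?nnegrE.
  have xd : 0 <= x s ^+ 2 * (c ^+ 2 - d s ^+ 2).
    by rewrite mulr_ge0 ?exprn_even_ge0 // subr_ge0.
  have dd : 0 <= (c ^+ 2 + d s ^+ 2) * (c ^+ 2 - d s ^+ 2).
    by rewrite mulr_ge0 ?subr_ge0 // addr_ge0 ?exprn_even_ge0.
  have sq : 0 <= d s ^+ 2 * (x s - d s) ^+ 2 by rewrite mulr_ge0 ?exprn_even_ge0.
  nra.
move=> le; apply: le_trans le _; rewrite x3 mulr0 addr0.
have := var_le m; rewrite -/x => v.
have {}v : 8 * c ^+ 2 * bern_exp (fun s => x s ^+ 2) <= 8 * m%:R * c ^+ 4.
  rewrite (_ : 8 * m%:R * c ^+ 4 = 8 * c ^+ 2 * (m%:R * c ^+ 2)); last by ring.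
  by rewrite ler_wpM2l // mulr_ge0 // exprn_even_ge0.
rewrite -/x in IH; rewrite -natr1.
have c40 : 0 <= c ^+ 4 by rewrite exprn_even_ge0.
rewrite [leRHS](_ : _ = 4 * m%:R ^+ 2 * c ^+ 4 + 8 * m%:R * c ^+ 4 + 4 * c ^+ 4); last by ring.
by lra.
Qed.

(** The increments of the martingale that exposes the [n] blocks one by one
    are bounded by [c], so its fourth moment grows like [n ^ 2 * c ^ 4]. *)
Lemma bern_fourth_moment :
  bern_exp (fun s => (f s - bern_exp f) ^+ 4) <= 4 * n%:R ^+ 2 * c ^+ 4.
Proof.
rewrite (@eq_bern_exp _ (fun s => (g n s - g 0 s) ^+ 4)) //.
move=> s; congr ((_ - _) ^+ 4).
  rewrite /g -[LHS]bern_exp_cst; apply: eq_bern_exp => t; congr f.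
  by apply/ffunP => k; rewrite ffunE leqNgt bn.
by apply: eq_bern_exp => t; congr f; apply/ffunP => k; rewrite ffunE.
Qed.

End BoundedDifferences.
End ProductBernoulli.

(** * Lukasiewicz sums and Lagrange inversion *)

Section Lukasiewicz.
Context {R : numFieldType}.
Variable L : nat -> R.

(** Total weight of the ordered forests with [k] roots and [m] vertices, where
    a vertex with [j] children weighs [L j.+1]. The recursion removes the first
    root and puts its children in front of the other roots, which encodes
    forests as Lukasiewicz paths. *)
Fixpoint luk (m k : nat) : R :=
  match m, k with
  | 0, _ => (k == 0)%:R
  | _.+1, 0 => 0
  | m'.+1, k'.+1 => \sum_(j < m'.+1 - k') L j.+1 * luk m' (k' + j)
  end.

Lemma lukSS m k : luk m.+1 k.+1 = \sum_(j < m.+1 - k) L j.+1 * luk m (k + j).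
Proof. by []. Qed.

Lemma lukS0 m : luk m.+1 0 = 0. Proof. by []. Qed.

Arguments luk : simpl never.

Definition luk_poly N : {poly R} := \poly_(j < N) L j.+1.

Lemma coefXderiv (p : {poly R}) k : ('X * p^`())`_k = p`_k *+ k.
Proof. by rewrite coefXM; case: k => [|k]; rewrite ?mulr0n //= coef_deriv. Qed.

Lemma derivXexp (p : {poly R}) m : 'X * (p ^+ m.+1)^`() = ('X * p^`()) * p ^+ m *+ m.+1.
Proof. by rewrite deriv_exp /= mulrnAr mulrA. Qed.

(** Lagrange inversion: [luk m k] is the coefficient of [z ^ m] in the [k]-th
    power of the solution of [u = z * phi(u)]. Both sides satisfy the recursion
    of [luk], the right one because the coefficients of [phi ^ m.+2] and of its
    derivative are convolutions of those of [phi ^ m.+1] with those of [phi]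
    and of its derivative. *)
Lemma luk_lagrange N m k : (0 < m <= N)%N -> (k <= m)%N ->
  luk m k *+ m = (luk_poly N ^+ m)`_(m - k) *+ k.
Proof.
case: m => // m /=; elim: m k => [|m IH] k mN km.
  case: k km => [|[|k]] // _.
  by rewrite lukSS subn0 big_ord1 /luk mulr1 expr1 subnn coef_poly mN.
case: k km => [|k] km; first by rewrite mulr0n mul0rn.
set phi := luk_poly N; have mN' : (m < N)%N by apply: ltnW.
rewrite subSS; set d := (m.+1 - k)%N.
have dE : luk m.+2 k.+1 *+ m.+1 =
    \sum_(j < d.+1) phi`_j * (phi ^+ m.+1)`_(d - j) *+ (k + j).
  rewrite lukSS subSn // -/d -sumrMnl; apply: eq_bigr => j _.
  have jd : (j <= d)%N by rewrite -ltnS.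
  rewrite [LHS](_ : _ = L j.+1 * (luk m.+1 (k + j) *+ m.+1)) ?mulrnAr // -mulrnAr IH //; last by rewrite -leq_subRL.
  rewrite coef_poly ifT; last by rewrite (leq_ltn_trans jd) // (leq_ltn_trans (leq_subr _ _)).
  by rewrite subnDA mulrnAr.

have c1 : \sum_(j < d.+1) phi`_j * (phi ^+ m.+1)`_(d - j) = (phi ^+ m.+2)`_d.
  by rewrite [in RHS]exprS coefM.
have c2 : (\sum_(j < d.+1) phi`_j * (phi ^+ m.+1)`_(d - j) *+ j) *+ m.+2 =
    (phi ^+ m.+2)`_d *+ d.
  rewrite -coefXderiv derivXexp coefMn coefM; congr (_ *+ _).
  by apply: eq_bigr => j _; rewrite coefXderiv mulrnAl.
apply: (@mulIf _ m.+1%:R); first by rewrite pnatr_eq0.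
rewrite !mulr_natr mulrnAC dE.
under eq_bigr do rewrite mulrnDr.
rewrite big_split /= mulrnDl c2 sumrMnl c1 -!mulrnA -mulrnDr; congr (_ *+ _).
by rewrite /d; move: km; clear; rewrite ltnS => km; nia.
Qed.

(** The same computation for a tree whose root weighs [L i] when it has [i]
    children: the left side times [s] is a coefficient of
    [(t * phi)' * phi ^ s], which is a multiple of one of [phi ^ s.+1]. *)
Lemma luk_sum s : (0 < s)%N -> L 0 = 1 ->
  \sum_(i < s.+1) L i * luk s i = 2 / s.+1%:R * (luk_poly s ^+ s.+1)`_s.-1.
Proof.
case: s => // s _ L0 /=; set phi := luk_poly s.+1.
have s0 : s.+1%:R != 0 :> R by rewrite pnatr_eq0.
have s1 : s.+2%:R != 0 :> R by rewrite pnatr_eq0.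
apply: (mulIf s0); rewrite mulr_natr -sumrMnl big_ord_recl lukS0 mulr0 mul0rn add0r.
have -> : \sum_(i < s.+1) L (lift ord0 i) * luk s.+1 (lift ord0 i) *+ s.+1 =
   \sum_(i < s.+1) phi`_i * (phi ^+ s.+1)`_(s - i) *+ i.+1.
  apply: eq_bigr => i _; rewrite -mulrnAr lift0 (@luk_lagrange s.+1) ?ltnSn //.
  by rewrite mulrnAr coef_poly ltn_ord subSS.
have c1 : \sum_(j < s.+1) phi`_j * (phi ^+ s.+1)`_(s - j) = (phi ^+ s.+2)`_s.
  by rewrite [in RHS]exprS coefM.
have c2 : (\sum_(j < s.+1) phi`_j * (phi ^+ s.+1)`_(s - j) *+ j) * s.+2%:R =
    (phi ^+ s.+2)`_s * s%:R.
  rewrite !mulr_natr -coefXderiv derivXexp coefMn coefM; congr (_ *+ _).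
  by apply: eq_bigr => j _; rewrite coefXderiv mulrnAl.
under eq_bigr do rewrite mulrS.
rewrite big_split /= c1; apply: (mulIf s1); rewrite mulrDl c2.
have {}s1 : s%:R + 1 + 1 != 0 :> R by rewrite !natr1.
by rewrite -!natr1; field.
Qed.

End Lukasiewicz.
Arguments luk : simpl never.

Section Multinomial.
Context {R : numFieldType}.

(** The multinomial theorem in disguise: truncated exponentials are
    multiplicative below the truncation order, while multiplying them out
    enumerates all tuples of exponents. *)
Lemma coef_prod_trunc_exp (A : comNzRingType) (inv : nat -> A) (B N : nat)
    (y : 'I_N -> A) (M : nat) :
  (forall i, inv i * i`!%:R = 1) -> (M < B)%N ->
  (\prod_(j < N) \poly_(i < B) (inv i * y j ^+ i))`_M = inv M * (\sum_(j < N) y j) ^+ M.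
Proof.
move=> invE.
have invM i M' : (i <= M')%N -> inv i * inv (M' - i)%N = inv M' * 'C(M', i)%:R.
  move=> iM; transitivity (inv i * inv (M' - i)%N * (inv M' * M'`!%:R)).
    by rewrite invE mulr1.
  rewrite -(bin_fact iM) !natrM.
  have -> : inv i * inv (M' - i)%N * (inv M' * ('C(M', i)%:R * (i`!%:R * (M' - i)`!%:R)))
    = (inv i * i`!%:R) * (inv (M' - i)%N * (M' - i)`!%:R) * (inv M' * 'C(M', i)%:R) by ring.
  by rewrite !invE !mul1r.
have inv0 : inv 0 = 1 by have := invE 0; rewrite fact0 mulr1.
elim: (index_enum _) M => [|j r IH] M MB.
  rewrite !big_nil coefC; case: M MB => [|M] _; first by rewrite inv0 mul1r.
  by rewrite expr0n mulr0.
rewrite !big_cons addrC exprDn coefM mulr_sumr; apply: eq_bigr => i _.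
have iM : (i <= M)%N by rewrite -ltnS.
rewrite coef_poly (leq_ltn_trans iM MB) IH; last exact: leq_ltn_trans (leq_subr _ _) MB.
rewrite -mulr_natr; have := invM _ _ iM => e.
transitivity (inv i * inv (M - i)%N * (y j ^+ i * (\sum_(j <- r) y j) ^+ (M - i))).
  by ring.
by rewrite e; ring.
Qed.

End Multinomial.

Lemma coef_luk_poly_exp {R : realType} (L : nat -> R) s : (0 < s)%N ->
  (luk_poly L s ^+ s.+1)`_s.-1 =
  \sum_(r : {ffun 'I_s -> 'I_s.+2} | in_Rs r)
     multinomial r * \prod_(j < s) L j.+1 ^+ r j.
Proof.
move=> s0; pose inv i : {poly R} := (i`!%:R^-1)%:P.
pose y (j : 'I_s) : {poly R} := L j.+1 *: 'X^j.
have f0 i : i`!%:R != 0 :> R by rewrite pnatr_eq0 -lt0n fact_gt0.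
have invE i : inv i * i`!%:R = 1 by rewrite /inv -polyC_natr -polyCM mulVf.
have := coef_prod_trunc_exp y invE (ltnSn s.+1).
have -> : \sum_(j < s) y j = luk_poly L s by rewrite /luk_poly poly_def.
under eq_bigr do rewrite poly_def.
rewrite bigA_distr_bigA /= coef_sum => /(congr1 (fun p : {poly R} => (s.+1)`!%:R * p`_s.-1)).
rewrite [X in _ = _ * X]coefCM mulrA divff // mul1r => <-.
rewrite coef_sum mulr_sumr [RHS]big_mkcond /=; apply: eq_bigr => r _.
have -> : \prod_(j < s) ((inv (r j) * y j ^+ r j) *: 'X^(r j)) =
    (\prod_(j < s) (inv (r j) * y j ^+ r j)) *: 'X^(\sum_(j < s) r j).
  by rewrite expr_sum -scaler_prod.
rewrite coefZ coefXn /in_Rs eq_sym; case: eqP => [rs|_]; last first.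
  by rewrite mulr0 coef0 mulr0.
rewrite mulr1 big_split /= /inv -rmorph_prod /= coefCM.
have -> : \prod_(j < s) y j ^+ r j =
    (\prod_(j < s) L j.+1 ^+ r j) *: 'X^(\sum_(j < s) j * r j).
  rewrite expr_sum -scaler_prod; apply: eq_bigr => j _.
  by rewrite /y exprZn exprM.
rewrite coefZ coefXn.
have -> : (\sum_(j < s) j.+1 * r j == 2 * s)%N = (s.-1 == \sum_(j < s) j * r j)%N.
  under eq_bigr do rewrite mulSn.
  by rewrite big_split /= rs; move: (\sum_(j < s) _)%N s0 => k; clear; lia.
case: eqP => _ /=; last by rewrite !mulr0.
by rewrite mulr1 mulrA /multinomial prodfV.
Qed.

Lemma luk_sum_even_moment {R : realType} (L : nat -> R) s : (0 < s)%N -> L 0 = 1 ->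
  \sum_(i < s.+1) L i * luk L s i = even_moment L s.
Proof.
move=> s0 L0; rewrite luk_sum // coef_luk_poly_exp // mulr_sumr.
by apply: eq_bigr => r _; rewrite mulrA.
Qed.

Section StackSum.
Context {R : realType}.
Variables (n : nat) (x : 'I_n -> R).

(** Weight of the walks that alternately discover and leave the vertices of a
    tree, seen from their current branch: only the values of [x] along that
    branch matter. A step pushes a vertex [y], with weight [a * x y / n] where
    [a] is on top, or pops; in the end only the root may be left. *)
Fixpoint stack_sum (k : nat) (st : seq R) : R :=
  match st with
  | [::] => 0
  | a :: st' => match k with
    | 0 => (st' == [::])%:R
    | k'.+1 => n%:R^-1 * \sum_(y < n) a * x y * stack_sum k' (x y :: st)
               + stack_sum k' st'
    end
  end.

Lemma stack_sum_parity k st : odd k = odd (size st) -> stack_sum k st = 0.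
Proof.
elim: k st => [|k IH] [|a st] //=; first by case: st.
move=> /negb_inj kst; rewrite IH // addr0 big1 ?mulr0 // => y _.
by rewrite IH ?mulr0 //= negbK.
Qed.

Lemma stack_sum_long k st : (k.+1 < size st)%N -> stack_sum k st = 0.
Proof.
elim: k st => [|k IH] [|a st] //= kst; first by case: st kst.
rewrite IH // addr0 big1 ?mulr0 // => y _; rewrite IH ?mulr0 //=.
by rewrite ltnS (ltn_trans _ kst) // ltnW.
Qed.

(** Complete homogeneous symmetric polynomials *)
Fixpoint hsym (st : seq R) (k : nat) : R :=
  if st is a :: st' then \sum_(j < k.+1) a ^+ j * hsym st' (k - j) else (k == 0)%:R.

Lemma hsym_cons a st k :
  hsym (a :: st) k = \sum_(j < k.+1) a ^+ j * hsym st (k - j).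
Proof. by []. Qed.

Arguments hsym : simpl never.

Lemma hsym0 st : hsym st 0 = 1.
Proof. by elim: st => // a st IH; rewrite hsym_cons big_ord1 mul1r IH. Qed.

Lemma hsymS a st k : hsym (a :: st) k.+1 = a * hsym (a :: st) k + hsym st k.+1.
Proof.
rewrite !hsym_cons big_ord_recl mul1r addrC mulr_sumr; congr (_ + _).
by apply: eq_bigr => j _; rewrite lift0 exprS mulrA.
Qed.

(** The weight of a vertex of degree [k] averaged over its possible names. *)
Definition emp_moment k : R := n%:R^-1 * \sum_(i < n) x i ^+ k.

Lemma triangular_sum (f : nat -> nat -> R) M :
  \sum_(i < M) \sum_(j < i.+1) f j (i - j)%N = \sum_(l < M) \sum_(j < M - l) f j l.
Proof.
elim: M => [|M IH]; first by rewrite !big_ord0.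
rewrite big_ord_recr IH [RHS]big_ord_recr /= subSnn big_ord1.
under [in RHS]eq_bigr => l _ do rewrite subSn ?(ltnW (ltn_ord l)) // big_ord_recr /=.
rewrite big_split /= -addrA; congr (_ + _).
rewrite (reindex_inj rev_ord_inj) /= big_ord_recr /= subnn; congr (_ + _); last first.
  by rewrite subn0.
by apply: eq_bigr => l _; rewrite subSS subKn // ltnW.
Qed.

(** A vertex of the branch that will get [j] more children contributes [a ^ j];
    sorting the walks by the total number [i] of these children leaves a forest
    with [i] roots, so that stacks are replaced by counters, i.e. Dyck paths by
    Lukasiewicz paths. *)
Lemma stack_sumE m k st : (k.+1 = m.*2 + size st)%N ->
  stack_sum k st = \sum_(i < m.+1) hsym st i * luk emp_moment m i.
Proof.
elim: k m st => [|k IH] m st.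
  case: m => [|m] // st1; case: st st1 => [|a [|b st]] // _.
  by rewrite big_ord1 hsym0 mul1r.
case: st => [|a st] /= km.
  case: m km => [|m] //= _; rewrite big_ord_recl /= lukS0 mulr0 add0r big1 // => i _.
  by rewrite /hsym mul0r.
rewrite (IH m st); last by lia.
case: m km => [|m] km.
  rewrite big1 => [|y _]; last by rewrite stack_sum_long ?mulr0 //=; lia.
  by rewrite mulr0 add0r !big_ord1 !hsym0.
have recl s : \sum_(i < m.+2) hsym s i * luk emp_moment m.+1 i =
    \sum_(i < m.+1) hsym s i.+1 * luk emp_moment m.+1 i.+1.
  by rewrite big_ord_recl lukS0 mulr0 add0r.
rewrite !recl; under [RHS]eq_bigr do rewrite hsymS mulrDl -mulrA.
rewrite [RHS]big_split /=; congr (_ + _).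
have kmS y : k.+1 = (m.*2 + size (x y :: a :: st))%N by rewrite /=; lia.
under eq_bigr => y _ do rewrite (IH m _ (kmS y)).
have moment_pull j (u v : R) :
    n%:R^-1 * \sum_y (a * x y * (x y ^+ j * u * v)) = a * (emp_moment j.+1 * u * v).
  rewrite /emp_moment !mulr_sumr !mulr_suml mulr_sumr.
  by apply: eq_bigr => y _; rewrite exprS; ring.
transitivity (\sum_(i < m.+1) \sum_(j < i.+1)
   a * (emp_moment j.+1 * hsym (a :: st) (i - j) * luk emp_moment m (j + (i - j)))).
  under eq_bigr do rewrite mulr_sumr.
  rewrite exchange_big mulr_sumr /=; apply: eq_bigr => i _.
  under eq_bigr => y _ do rewrite hsym_cons mulr_suml mulr_sumr.
  rewrite exchange_big mulr_sumr /=; apply: eq_bigr => j _.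
  rewrite subnKC -1?ltnS //; exact: moment_pull.
rewrite (triangular_sum (fun j l => a * (emp_moment j.+1 * hsym (a :: st) l * luk emp_moment m (j + l)))).
apply: eq_bigr => l _; rewrite lukSS !mulr_sumr; apply: eq_bigr => j _.
by rewrite [(j + l)%N]addnC; ring.
Qed.

Lemma mean_stack_sum m : (0 < n)%N ->
  n%:R^-1 * \sum_(u < n) stack_sum m.*2 [:: x u] =
  \sum_(i < m.+1) emp_moment i * luk emp_moment m i.
Proof.
move=> n0; under eq_bigr => u _ do rewrite (@stack_sumE m) ?addn1 //.
rewrite exchange_big mulr_sumr /=; apply: eq_bigr => i _.
rewrite -mulr_suml mulrA; congr (_ * _); rewrite /emp_moment; congr (_ * _).
apply: eq_bigr => u _; rewrite hsym_cons big_ord_recr big1 /= => [|j _].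
  by rewrite subnn /hsym mulr1 add0r.
by rewrite /hsym subn_eq0 leqNgt ltn_ord mulr0.
Qed.

Hypothesis n_gt0 : (0 < n)%N.
Variable C : R.
Hypothesis x0C : forall i, 0 <= x i <= C.
Hypothesis mean1 : \sum_i x i = n%:R.

Lemma stack_sum_ge0_le k st : all (fun a => 0 <= a <= C) st ->
  0 <= stack_sum k st <= (C + 1) ^+ k.
Proof.
have C0 : 0 <= C.
  by have /andP[h1 h2] := x0C (Ordinal n_gt0); apply: le_trans h2.
have C1 k' : 0 <= (C + 1) ^+ k' by rewrite exprn_ge0 // addr_ge0.
elim: k st => [|k IH] [|a st] //= st0; first by rewrite lexx ler01.
- by rewrite ler0n lern1 leq_b1.
- by rewrite lexx C1.
have /andP[/andP[a0 aC] stC] := st0.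
have /andP[s0 sC] := IH st stC.
have y0 y : 0 <= stack_sum k (x y :: a :: st) <= (C + 1) ^+ k.
  by apply: IH; rewrite /= x0C st0.
have nR : 0 < n%:R :> R by rewrite ltr0n.
apply/andP; split.
  rewrite addr_ge0 // mulr_ge0 ?invr_ge0 // sumr_ge0 // => y _.
  have /andP[? _] := y0 y; have /andP[? _] := x0C y.
  by rewrite !mulr_ge0.
rewrite exprS mulrDl mul1r lerD // ler_pdivrMl //.
apply: (@le_trans _ _ (\sum_y C * (C + 1) ^+ k * x y)); last first.
  by rewrite -mulr_sumr mean1 mulrC.
apply: ler_sum => y _; have /andP[z0 zC] := y0 y; have /andP[xy0 xyC] := x0C y.
by rewrite mulrAC ler_wpM2r // ler_pM.
Qed.

End StackSum.

(** * Closed walks in the random graph *)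

Section WalkSum.
Context {R : realType} {I : finType}.
Variables (n : nat) (ed : 'I_n -> 'I_n -> I) (p : I -> R) (s : R).

(** The sum over the walks of [k] more steps from [u] to [r] of the expected
    weight, given that the edges [es] are present: a repeated edge costs no
    further factor [p]. *)
Fixpoint walk_sum (r : 'I_n) (k : nat) (u : 'I_n) (es : seq I) : R :=
  if k is k'.+1 then
    \sum_y s * (if ed u y \in es then 1 else p (ed u y)) * walk_sum r k' y (ed u y :: es)
  else (u == r)%:R.

Lemma bern_exp_walk (r : 'I_n) k u es :
  bern_exp p (fun t => \prod_(e <- es) (t e)%:R *
     ((\matrix_(i, j) (s * (t (ed i j))%:R)) ^+ k) u r) =
  \prod_(e <- undup es) p e * walk_sum r k u es.
Proof.
elim: k u es => [|k IH] u es.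
  under eq_bern_exp do rewrite expr0 mxE mulrC.
  by rewrite bern_expZ bern_exp_prod mulrC.
under eq_bern_exp => t do rewrite exprS mxE mulr_sumr.
rewrite bern_exp_sum mulr_sumr /=; apply: eq_bigr => y _.
transitivity (s * bern_exp p (fun t => \prod_(e <- ed u y :: es) (t e)%:R *
     ((\matrix_(i, j) (s * (t (ed i j))%:R)) ^+ k) y r)).
  rewrite -bern_expZ; apply: eq_bern_exp => t; rewrite big_cons mxE.
  by rewrite !mulrA; congr (_ * _); rewrite -mulrA mulrC.
rewrite IH /=; case: ifP => _; first by rewrite mulr1 mulrCA.
rewrite big_cons -!mulrA [X in s * X]mulrCA; exact: mulrCA.
Qed.

Hypothesis ed_sym : forall i j, ed i j = ed j i.
Hypothesis ed_inj : forall i j k l, ed i j = ed k l ->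
  (i = k /\ j = l) \/ (i = l /\ j = k).

Lemma ed_injr i : injective (ed i).
Proof. by move=> j k e; have [[]|[-> ->]] := ed_inj e. Qed.

Lemma card_old_edges u es : (#|[pred y | ed u y \in es]| <= size es)%N.
Proof.
rewrite -(size_image (ed u) [pred y | ed u y \in es]); apply: uniq_leq_size.
  by rewrite map_inj_uniq ?enum_uniq //; exact: ed_injr.
by move=> e /mapP[y]; rewrite mem_enum inE => yes ->.
Qed.

Variables (x : 'I_n -> R) (C : R) (K : nat).
Hypotheses (n_gt0 : (0 < n)%N) (s_gt0 : 0 < s) (s_le1 : s <= 1).
Hypothesis x0C : forall i, 0 <= x i <= C.
Hypothesis mean1 : \sum_i x i = n%:R.
Hypothesis p_ed : forall i j, p (ed i j) = x i * x j / (n%:R * s ^+ 2).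

Let nR : 0 < n%:R :> R. Proof. by rewrite ltr0n. Qed.
Let C0 : 0 <= C.
Proof. by have /andP[h1 h2] := x0C (Ordinal n_gt0); apply: le_trans h2. Qed.
Let p0 i j : 0 <= p (ed i j).
Proof.
have /andP[? _] := x0C i; have /andP[? _] := x0C j.
by rewrite p_ed divr_ge0 ?mulr_ge0 ?exprn_ge0 ?(ltW s_gt0).
Qed.

Let Q := (K%:R + 1 + C) / s ^+ 2.

Let Q_ge1 : 1 <= Q.
Proof.
rewrite /Q ler_pdivlMr ?exprn_gt0 // mul1r (le_trans (exprn_ile1 _ (ltW s_gt0) s_le1)) //.
by rewrite addrAC lerDr addr_ge0.
Qed.

(** Every step multiplies the sum by at most the number of old edges plus the
    mean degree. *)
Lemma walk_sum_crude r k u es : (size es + k <= K)%N ->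
  0 <= walk_sum r k u es <= Q ^+ k.
Proof.
elim: k u es => [|k IH] u es esK /=; first by rewrite ler0n lern1 leq_b1.
have IHy y : 0 <= walk_sum r k y (ed u y :: es) <= Q ^+ k.
  by apply: IH; rewrite /= addSnnS.
have Qk0 : 0 <= Q ^+ k by rewrite exprn_ge0 // (le_trans ler01).
apply/andP; split.
  apply: sumr_ge0 => y _; have /andP[F0 _] := IHy y.
  by rewrite mulr_ge0 // mulr_ge0 ?(ltW s_gt0) //; case: ifP.
apply: (@le_trans _ _ (\sum_y ((ed u y \in es)%:R + s * p (ed u y)) * Q ^+ k)).
  apply: ler_sum => y _; have /andP[F0 FQ] := IHy y.
  rewrite ler_pM //; first by rewrite mulr_ge0 ?(ltW s_gt0) //; case: ifP.
  case: ifP => _; last by rewrite add0r.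
  by rewrite mulr1 (le_trans s_le1) // lerDl mulr_ge0 // ltW.
rewrite -mulr_suml exprS ler_wpM2r // big_split /=.
rewrite -natr_sum -[X in X%:R]big_mkcond /= sum1_card.
have u1 : \sum_y s * p (ed u y) = x u / s.
  under eq_bigr do rewrite p_ed.
  rewrite -mulr_sumr -mulr_suml -mulr_sumr mean1.
  by field; rewrite !gt_eqF.
rewrite u1 /Q mulrDl lerD //.
  rewrite ler_pdivlMr ?exprn_gt0 //.
  apply: (@le_trans _ _ (K%:R * 1)); last by rewrite mulr1 lerDl.
  apply: ler_pM; rewrite ?exprn_ge0 ?(ltW s_gt0) ?exprn_ile1 ?(ltW s_gt0) //.
  rewrite ler_nat (leq_trans (card_old_edges _ _)) // (leq_trans _ esK) //.
  exact: leq_addr.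
have /andP[u0 uC] := x0C u.
apply: ler_pM => //; first by rewrite invr_ge0 ltW.
by rewrite lef_pV2 ?posrE ?exprn_gt0 // expr2 ler_piMl // ltW.
Qed.

(** The edges [es] of the walk so far form a tree on its vertices [vs], in which
    [par] is the parent and [stk] lists the values of [x] on the path to the
    root. *)
Record tree_state r (vs : seq 'I_n) (es : seq I) (par : 'I_n -> 'I_n)
    (stk : 'I_n -> seq R) : Prop := TreeState {
  ts_root : r \in vs /\ stk r = [:: x r];
  ts_par : forall v, v \in vs -> v != r ->
    [/\ par v \in vs, ed v (par v) \in es & stk v = x v :: stk (par v)];
  ts_edge : forall a b, ed a b \in es ->
    [/\ a \in vs, b \in vs & (a != r /\ par a = b) \/ (b != r /\ par b = a)];
  ts_size : (size vs <= (size es).+1)%N;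
  ts_stk : forall v, v \in vs ->
    all (fun a => 0 <= a <= C) (stk v) /\ (size (stk v) <= (size es).+1)%N }.

Lemma tree_state_old r vs es par stk e :
  tree_state r vs es par stk -> e \in es -> tree_state r vs (e :: es) par stk.
Proof.
move=> [h1 h2 h3 h4 h5] ees.
have mem a : a \in e :: es -> a \in es by rewrite inE => /orP[/eqP->|].
split => //=.
- by move=> v vvs vr; have [? ? ?] := h2 v vvs vr; split => //; rewrite inE; apply/orP; right.
- by move=> a b /mem; apply: h3.
- exact: leqW.
- by move=> v /h5[? ?]; split => //; apply: leqW.
Qed.

Lemma tree_state_new r vs es par stk u y :
  tree_state r vs es par stk -> u \in vs -> y \notin vs ->
  tree_state r (y :: vs) (ed u y :: es)
    (fun v => if v == y then u else par v)
    (fun v => if v == y then x y :: stk u else stk v).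
Proof.
move=> [[h1 h1'] h2 h3 h4 h5] uvs yvs.
have ne v : v \in vs -> (v == y) = false.
  by move=> vvs; apply: contraNF yvs => /eqP <-.
split => /=.
- by rewrite inE h1 orbT ne.
- move=> v; rewrite inE => /orP[/eqP->|vvs] vr.
    by rewrite eqxx !inE uvs orbT ed_sym eqxx (ne u).
  have [pv ev sv] := h2 v vvs vr.
  by rewrite (ne v) // (ne (par v)) // !inE pv ev !orbT.
- move=> a b; rewrite inE => /orP[/eqP e|/h3[avs bvs ab]].
  + have yr : y != r by apply: contraNneq yvs => ->.
    by have [[-> ->]|[-> ->]] := ed_inj e; rewrite !inE eqxx uvs orbT;
      split => //; [right|left].
  + by rewrite !inE avs bvs !orbT (ne a) // (ne b).
- by rewrite ltnS.
- move=> v; rewrite inE; case: eqP => [_ _|_ /= vvs].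
    have [? ?] := h5 u uvs; split => /=; first by rewrite x0C.
    by rewrite ltnS.
  by have [? ?] := h5 v vvs; split => //; apply: leqW.
Qed.

Let Db := (C + 1) ^+ K.
Let Db0 : 0 <= Db. Proof. by rewrite exprn_ge0 // addr_ge0. Qed.

(** The three terms come from pushing an already visited vertex, which a stack
    allows but a tree does not, from going down a known edge, and from closing
    a cycle. *)
Definition walk_error : R :=
  C ^+ 2 * Db / n%:R + s ^+ 2 * Db + C ^+ 2 * Q ^+ K / (n%:R * s ^+ K.+1).

Let err0 : 0 <= walk_error.
Proof.
have Q0 : 0 <= Q by rewrite (le_trans ler01).
have s0 := ltW s_gt0.
by do ?[done|apply: addr_ge0|apply: divr_ge0|apply: mulr_ge0|apply: exprn_ge0].
Qed.

Let H : R := C + K%:R *+ 2 + 3.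
Let H0 : 0 <= H. Proof. by rewrite !addr_ge0 // mulrn_wge0. Qed.

(** A vertex at depth [h] carries a factor [s ^ h] for the steps back to the
    root. With this normalization, discovering a vertex and returning to the
    parent have weight of order 1, as in [stack_sum]. A step down a known edge
    loses a factor [s ^ 2], and closing a cycle loses a factor [n] up to powers
    of [s], even when the rest of the walk is bounded crudely. *)
Lemma walk_sum_approx r k u vs es par stk :
  tree_state r vs es par stk -> u \in vs -> (size es + k <= K)%N ->
  `|walk_sum r k u es - s ^+ (size (stk u)).-1 * stack_sum x k (stk u)| <=
  s ^+ (size (stk u)).-1 * (walk_error * H ^+ k).
Proof.
elim: k u vs es par stk => [|k IH] u vs es par stk ts uvs esK.
  have Hs : 0 <= s ^+ (size (stk u)).-1 * (walk_error * H ^+ 0).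
    by rewrite expr0 mulr1 mulr_ge0 // exprn_ge0 // ltW.
  have [[rvs stkr] hp _ _ _] := ts; rewrite /=.
  have [ur|ur] := eqVneq u r; first by move: Hs; rewrite ur stkr /= !expr0 !mul1r subrr normr0.
  move: Hs; have [pvs _ ->] := hp u uvs ur => Hs /=.
  suff -> : (stk (par u) == [::]) = false by rewrite mulr0 subrr normr0.
  have [pr|pr] := eqVneq (par u) r; first by rewrite pr stkr.
  by have [_ _ ->] := hp (par u) pvs pr.
have [[rvs stkr] hp he hs hst] := ts.
set d := (size (stk u)).-1; set er := walk_error * H ^+ k.
have s0 := ltW s_gt0.
have er0 : 0 <= er by rewrite mulr_ge0 // exprn_ge0.
have sd0 : 0 <= s ^+ d by rewrite exprn_ge0.
have [st0 szu] := hst u uvs.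
have stku : stk u = x u :: behead (stk u).
  have [->|ur] := eqVneq u r; first by rewrite stkr.
  by have [_ _ ->] := hp u uvs ur.
have kK : (k <= K)%N by apply: leq_trans esK; rewrite addnS ltnW // ltnS leq_addl.
have dK : (d <= K)%N.
  rewrite /d -subn1 leq_subLR; apply: leq_trans szu _; rewrite add1n ltnS.
  by apply: leq_trans esK; exact: leq_addr.
have D_le st : all (fun a => 0 <= a <= C) st -> 0 <= stack_sum x k st <= Db.
  move=> /(stack_sum_ge0_le n_gt0 x0C mean1 k)/andP[-> h] /=.
  by apply: le_trans h _; apply: ler_weXn2l kK; rewrite lerDr.
(* The step to [y] is compared with the push of [y], plus the pop when [y] is
   the parent of [u]. *)
pose q y := s * (if ed u y \in es then 1 else p (ed u y)) * walk_sum r k y (ed u y :: es).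
pose t1 y := s ^+ d * (n%:R^-1 * (x u * x y * stack_sum x k (x y :: stk u))).
pose t2 y := s ^+ d * ((y == par u) && (u != r))%:R * stack_sum x k (stk (par u)).
have target : s ^+ d * stack_sum x k.+1 (stk u) = \sum_y (t1 y + t2 y).
  rewrite big_split /= -!mulr_sumr stku /= -stku mulrDr; congr (_ + _).
  rewrite /t2; under [RHS]eq_bigr do rewrite -mulrA.
  rewrite -mulr_sumr -mulr_suml; congr (_ * _).
  rewrite -natr_sum (bigD1 (par u)) //= eqxx big1 /= ?addn0; last first.
    by move=> y /negPf ->.
  have [ur|ur] := eqVneq u r; first by rewrite ur stkr /= mul0r; case: (k).
  by rewrite mul1r; have [_ _ ->] := hp u uvs ur.
have t1_le y : 0 <= t1 y <= s ^+ d * (C ^+ 2 * Db / n%:R).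
  have /andP[xu0 xuC] := x0C u; have /andP[xy0 xyC] := x0C y.
  have /andP[D0 DD] : 0 <= stack_sum x k (x y :: stk u) <= Db.
    by apply: D_le; rewrite /= x0C.
  rewrite /t1 !mulr_ge0 ?invr_ge0 //= ler_wpM2l // [leRHS]mulrC ler_wpM2l ?invr_ge0 //.
  by rewrite expr2 !ler_pM ?mulr_ge0.
have esK' y : (size (ed u y :: es) + k <= K)%N by rewrite /= addSnnS.
have fresh y : y \notin vs -> `|q y - (t1 y + t2 y)| <= s ^+ d * (C * er) * (x y / n%:R).
  move=> yvs; have /negPf nes : ed u y \notin es.
    by apply: contra yvs => /he[].
  have -> : t2 y = 0.
    rewrite /t2; case: eqP => [yp|_] /=; last by rewrite mulr0 mul0r.
    case: eqP => [_|/eqP ur] /=; first by rewrite mulr0 mul0r.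
    by have [pvs _ _] := hp u uvs ur; rewrite yp pvs in yvs.
  have := IH y _ _ _ _ (tree_state_new ts uvs yvs) (mem_head _ _) (esK' y).
  have dE : size (stk u) = d.+1 by rewrite /d stku.
  rewrite eqxx /= dE => h; rewrite addr0 /q nes p_ed /t1.
  have -> : s * (x u * x y / (n%:R * s ^+ 2)) * walk_sum r k y (ed u y :: es) -
     s ^+ d * (n%:R^-1 * (x u * x y * stack_sum x k (x y :: stk u))) =
    (x u * x y / (n%:R * s)) * (walk_sum r k y (ed u y :: es) -
        s ^+ d.+1 * stack_sum x k (x y :: stk u)).
    rewrite [s ^+ d.+1]exprS; move: (s ^+ d) (walk_sum _ _ _ _) (stack_sum _ _ _) => a b c.
    by field; rewrite !gt_eqF.
  have /andP[xu0 xuC] := x0C u; have /andP[xy0 xyC] := x0C y.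
  have w0 : 0 <= x u * x y / (n%:R * s) by rewrite divr_ge0 ?mulr_ge0.
  rewrite normrM (ger0_norm w0); apply: le_trans (ler_wpM2l w0 h) _.
  rewrite [s ^+ d.+1]exprS -/er.
  have -> : x u * x y / (n%:R * s) * (s * s ^+ d * er) = s ^+ d * (x u * er) * (x y / n%:R).
    by move: (s ^+ d) => b; field; rewrite !gt_eqF.
  by rewrite ler_wpM2r ?divr_ge0 // ler_wpM2l // ler_wpM2r.
have stk_cons v : v \in vs -> stk v = x v :: behead (stk v).
  move=> vvs; have [->|vr] := eqVneq v r; first by rewrite stkr.
  by have [_ _ ->] := hp v vvs vr.
have e1 : 0 <= C ^+ 2 * Db / n%:R.
  by do ?[done|apply: divr_ge0|apply: mulr_ge0|apply: exprn_ge0].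
have e2 : 0 <= s ^+ 2 * Db by rewrite mulr_ge0 // exprn_ge0.
have Q0 : 0 <= Q by rewrite (le_trans ler01).
have e3 : 0 <= C ^+ 2 * Q ^+ K / (n%:R * s ^+ K.+1).
  by do ?[done|apply: divr_ge0|apply: mulr_ge0|apply: exprn_ge0].
have seen y : y \in vs -> `|q y - (t1 y + t2 y)| <=
    s ^+ d * (((y == par u) && (u != r))%:R * er + (walk_error + er)).
  move=> yvs; have /andP[t10 t1D] := t1_le y.
  have /andP[F0 FQ] := walk_sum_crude r y (esK' y).
  have IHy (ues : ed u y \in es) := IH y _ _ _ _ (tree_state_old ts ues) yvs (esK' y).
  have [/andP[/eqP ypar ur]|npar] := boolP ((y == par u) && (u != r)).
    have [_ ues stku'] := hp u uvs ur; rewrite -ypar in ues stku'.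
    have dE : d = (size (stk y)).-1.+1.
      by rewrite /d stku' /= (stk_cons y yvs).
    have := IHy ues; rewrite -/er /q ues /t2 ypar eqxx ur /= -ypar mulr1 mulr1 => h.
    have -> : s * walk_sum r k y (ed u y :: es) - (t1 y + s ^+ d * stack_sum x k (stk y))
      = s * (walk_sum r k y (ed u y :: es) - s ^+ (size (stk y)).-1 * stack_sum x k (stk y)) - t1 y.
      by rewrite [in s ^+ d]dE exprS; ring.
    apply: le_trans (ler_normB _ _) _; rewrite (ger0_norm t10) normrM (ger0_norm s0).
    apply: le_trans (lerD (ler_wpM2l s0 h) t1D) _.
    have -> : s * (s ^+ (size (stk y)).-1 * er) = s ^+ d * er.
      by rewrite [in RHS]dE exprS mulrA.
    by rewrite -mulrDr ler_wpM2l // /walk_error mul1r; lra.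
  have -> : t2 y = 0 by rewrite /t2 (negPf npar) mulr0 mul0r.
  rewrite /= mul0r add0r addr0.
  have q0 : 0 <= q y.
    by rewrite /q !mulr_ge0 //; case: ifP.
  apply: le_trans (ler_normB _ _) _; rewrite (ger0_norm t10) (ger0_norm q0).
  suff qle : q y <= s ^+ d * (s ^+ 2 * Db + er + C ^+ 2 * Q ^+ K / (n%:R * s ^+ K.+1)).
    apply: le_trans (lerD qle t1D) _.
    by rewrite -mulrDr ler_wpM2l // /walk_error; lra.
  have [ues|ues] := boolP (ed u y \in es); last first.
    have /andP[xu0 xuC] := x0C u; have /andP[xy0 xyC] := x0C y.
    have sdK : 1 <= s ^+ d / s ^+ K.
      by rewrite ler_pdivlMr ?exprn_gt0 // mul1r; apply: ler_wiXn2l dK.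
    apply: (@le_trans _ _ (s ^+ d * (C ^+ 2 * Q ^+ K / (n%:R * s ^+ K.+1)))); last first.
      by rewrite ler_wpM2l // lerDr addr_ge0.
    have -> : s ^+ d * (C ^+ 2 * Q ^+ K / (n%:R * s ^+ K.+1)) =
        C ^+ 2 * Q ^+ K / (n%:R * s) * (s ^+ d / s ^+ K).
      have sK : s ^+ K != 0 by rewrite expf_neq0 // gt_eqF.
      rewrite [s ^+ K.+1]exprS; move: (s ^+ d) (s ^+ K) sK (Q ^+ K) => a b b0 c.
      by field; rewrite b0 !gt_eqF.
    have -> : q y = x u * x y * walk_sum r k y (ed u y :: es) / (n%:R * s).
      rewrite /q (negPf ues) p_ed; move: (walk_sum _ _ _ _) => b.
      by field; rewrite !gt_eqF.
    rewrite -[leLHS]mulr1; apply: ler_pM => //.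
      by rewrite divr_ge0 ?mulr_ge0.
    rewrite ler_wpM2r ?invr_ge0 ?mulr_ge0 // ler_pM ?mulr_ge0 //.
      by rewrite expr2 ler_pM.
    by apply: le_trans FQ _; apply: ler_weXn2l kK.
  have [_ _ [[ur pu]|[yr py]]] := he _ _ ues.
    by rewrite pu eqxx ur in npar.
  have [_ _ stky] := hp y yvs yr; rewrite py in stky.
  have := IHy ues; rewrite stky /= -/er (stk_cons u uvs) /= -(stk_cons u uvs).
  have dE : size (behead (stk u)) = d by rewrite size_behead.
  rewrite dE ler_distl => /andP[_ h]; rewrite /q ues mulr1.
  have /andP[D0 DD] : 0 <= stack_sum x k (x y :: stk u) <= Db.
    by apply: D_le; rewrite /= x0C.
  apply: le_trans (ler_wpM2l s0 h) _.
  have -> : s * (s ^+ d.+1 * stack_sum x k (x y :: stk u) + s ^+ d.+1 * er) =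
      s ^+ d * (s * s * stack_sum x k (x y :: stk u) + s * s * er).
    by rewrite !exprS; move: (s ^+ d) => a; ring.
  rewrite ler_wpM2l //.
  have s2 : s * s <= 1 by rewrite -expr2 exprn_ile1.
  have h1 : s * s * stack_sum x k (x y :: stk u) <= s ^+ 2 * Db.
    by rewrite -expr2 ler_wpM2l // exprn_ge0.
  have h2 : s * s * er <= er by rewrite ler_piMl.
  by lra.
have we_er : walk_error <= er.
  rewrite /er ler_peMr // exprn_ege1 // /H.
  by apply: (@le_trans _ _ 3); rewrite ?ler1n // lerDr addr_ge0 // mulrn_wge0.
have vsK : #|[pred y | y \in vs]|%:R <= K%:R + 1 :> R.
  rewrite natr1 ler_nat (leq_trans (card_size _)) // (leq_trans hs) // ltnS.
  by apply: leq_trans esK; exact: leq_addr.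
have bound y : `|q y - (t1 y + t2 y)| <= s ^+ d * (C * er) * (x y / n%:R) +
   s ^+ d * (((y == par u) && (u != r))%:R * er + (y \in vs)%:R * (er *+ 2)).
  have b0 : 0 <= ((y == par u) && (u != r))%:R * er by rewrite mulr_ge0.
  have /andP[xy0 _] := x0C y.
  have [yvs|yvs] := boolP (y \in vs).
    apply: le_trans (seen y yvs) _; rewrite mul1r.
    apply: (@le_trans _ _ (s ^+ d * (((y == par u) && (u != r))%:R * er + er *+ 2))).
      by rewrite ler_wpM2l // lerD2l mulr2n lerD2r.
    rewrite lerDr; by do ?[done|apply: mulr_ge0|apply: divr_ge0].
  apply: le_trans (fresh y yvs) _.
  by rewrite mul0r addr0 lerDl mulr_ge0.
rewrite target -sumrB; apply: le_trans (ler_norm_sum _ _ _) _.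
apply: le_trans (ler_sum _ (fun y _ => bound y)) _.
rewrite big_split /= -!mulr_sumr -mulr_suml mean1.
rewrite divff ?(negbT (gt_eqF nR)) // mulr1.
rewrite -mulrDr ler_wpM2l // big_split /= -!mulr_suml -!natr_sum.
have par1 : (\sum_y ((y == par u) && (u != r)) <= 1)%N.
  rewrite (bigD1 (par u)) //= big1 ?addn0 ?leq_b1 // => y /negPf ->.
  by [].
have vsE : (\sum_(y < n) (y \in vs) = #|[pred y | y \in vs]|)%N.
  rewrite -sum1_card [RHS]big_mkcond /=; apply: eq_bigr => y _.
  by rewrite inE; case: (y \in vs).
rewrite vsE.
have m1 : (\sum_y ((y == par u) && (u != r)))%N%:R * er <= er.
  by rewrite ler_piMl // lern1.
have m2 : #|[pred y | y \in vs]|%:R * (er *+ 2) <= (K%:R + 1) * (er *+ 2).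
  by rewrite ler_wpM2r // mulrn_wge0.
rewrite exprSr mulrA -/er; apply: le_trans (lerD (lexx _) (lerD m1 m2)) _.
suff -> : C * er + (er + (K%:R + 1) * (er *+ 2)) = er * H by [].
by rewrite /H; ring.
Qed.

Lemma walk_sum_root r k : (k <= K)%N ->
  `|walk_sum r k r [::] - stack_sum x k [:: x r]| <= walk_error * H ^+ k.
Proof.
move=> kK.
have st : tree_state r [:: r] [::] id (fun=> [:: x r]).
  split => //.
  - by rewrite inE eqxx.
  - by move=> v; rewrite inE => ->.
  - by move=> v _; rewrite /= x0C.
have := walk_sum_approx st (mem_head r _) kK.
by rewrite /= expr0 !mul1r.
Qed.

End WalkSum.

(** * The random matrix as a function of independent bits *)

Section Model.
Variable n : nat.

(** One independent bit per unordered pair, loops included. *)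
Definition upair := {k : 'I_n * 'I_n | (k.1 <= k.2)%N}.

Lemma sort_pair_le (i j : 'I_n) :
  ((if (i <= j)%N then (i, j) else (j, i)).1 <= (if (i <= j)%N then (i, j) else (j, i)).2)%N.
Proof. by case: (leqP i j) => //= /ltnW. Qed.

Definition edge (i j : 'I_n) : upair :=
  exist (fun k : 'I_n * 'I_n => (k.1 <= k.2)%N) _ (sort_pair_le i j).

Lemma edge_sym i j : edge i j = edge j i.
Proof.
apply: val_inj => /=; case: (ltngtP i j) => // ij.
by rewrite (val_inj ij).
Qed.

Lemma edge_inj i j k l : edge i j = edge k l ->
  (i = k /\ j = l) \/ (i = l /\ j = k).
Proof.
by move=> /(congr1 val) /=; case: ifP => _; case: ifP => _ [-> ->]; [left|right|right|left].
Qed.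

Lemma edge_min i j (k : upair) : edge i j = k -> (val k).1 = i \/ (val k).1 = j.
Proof. by move=> <- /=; case: ifP; [left|right]. Qed.

Context {R : realType}.
Variables (p : upair -> R) (s : R).
Hypothesis p01 : forall k, 0 <= p k <= 1.
Implicit Types t : {ffun upair -> bool}.

Definition model_mx t : 'M[R]_n := \matrix_(i, j) (s * (t (edge i j))%:R).

Lemma model_mx_sym t : (model_mx t)^T = model_mx t.
Proof. by apply/matrixP => i j; rewrite !mxE edge_sym. Qed.

Definition mean_moment k : R := bern_exp p (fun t => n%:R^-1 * \tr (model_mx t ^+ k)).
Definition mean_esd x : R := bern_exp p (fun t => esd (model_mx t) x).

Lemma mean_mom (q : {poly R}) : mom mean_moment q =
  bern_exp p (fun t => n%:R^-1 * \sum_(l <- eigenvalues (model_mx t)) q.[l]).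
Proof.
rewrite /mom /mean_moment.
under eq_bigr do rewrite -bern_expZ.
rewrite -bern_exp_sum; apply: eq_bern_exp => t.
under eq_bigr do rewrite mulrCA -(sum_eigenvalues_pow _ (model_mx_sym t)).
rewrite -mulr_sumr; congr (_ * _).
under eq_bigr do rewrite mulr_sumr.
by rewrite exchange_big; apply: eq_bigr => l _; rewrite horner_coef.
Qed.

Lemma mean_is_cdf_of : (0 < n)%N -> is_cdf_of mean_moment mean_esd.
Proof.
move=> n0; have nV : 0 <= n%:R^-1 :> R by rewrite invr_ge0.
split.
- rewrite /mean_moment; under eq_bern_exp do rewrite expr0 mxtrace1 mulVf ?pnatr_eq0 -?lt0n //.
  exact: bern_exp_cst.
- move=> q q0; rewrite mean_mom -[leLHS](bern_exp_cst p); apply: ler_bern_exp => // t.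
  by apply: mulr_ge0 => //; apply: sumr_ge0.
- move=> q x qx; rewrite mean_mom; apply: ler_bern_exp => // t.
  by rewrite sum_le_esd; apply: ler_wpM2l => //; apply: ler_sum.
- move=> q x qx; rewrite mean_mom; apply: ler_bern_exp => // t.
  by rewrite sum_le_esd; apply: ler_wpM2l => //; apply: ler_sum.
Qed.

Lemma mean_momentE k : mean_moment k =
  n%:R^-1 * \sum_r walk_sum edge p s r k r [::].
Proof.
rewrite /mean_moment bern_expZ /mxtrace bern_exp_sum; congr (_ * _).
apply: eq_bigr => r _; have := bern_exp_walk edge p s r k r [::].
rewrite big_nil mul1r => <-; apply: eq_bern_exp => t.
by rewrite big_nil mul1r.
Qed.

(** Resampling the edges whose smaller endpoint is a given vertex changes one
    row and one column, hence the spectral distribution by at most [2 / n]; so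
    its fluctuations have fourth moment of order [n ^ -2]. *)
Lemma esd_concentration x e : (0 < n)%N -> 0 < e ->
  bern_exp p (fun t => (e <= `|esd (model_mx t) x - mean_esd x|)%R%:R) <=
  64 / e ^+ 4 / n%:R ^+ 2.
Proof.
move=> n0 e0; apply: le_trans (bern_markov4 p01 _ _ e0) _.
have nR : 0 < n%:R :> R by rewrite ltr0n.
rewrite mulrAC ler_wpM2r ?invr_ge0 ?exprn_ge0 ?(ltW e0) //.
have h := @bern_fourth_moment R _ p p01 (fun k => (val k).1 : nat) n
  (fun t => esd (model_mx t) x) (2 / n%:R).
have c0 : 0 <= 2 / n%:R :> R by rewrite divr_ge0.
apply: le_trans (h _ c0 _) _ => // [m t u tu|]; last first.
  rewrite (_ : 4 * n%:R ^+ 2 * (2 / n%:R) ^+ 4 = 64 / n%:R ^+ 2) //.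
  by field; rewrite gt_eqF.
have [mn|nm] := ltnP m n; last first.
  rewrite (_ : t = u) ?subrr ?normr0 //; apply/ffunP => k; apply: tu.
  by rewrite neq_ltn (leq_trans (ltn_ord _) nm).
apply: (@esd_cross_change _ _ _ _ (Ordinal mn)); [exact: model_mx_sym|exact: model_mx_sym|].
move=> i j im jm; rewrite !mxE tu //.
by have [->|->] := edge_min (erefl (edge i j)).
Qed.

End Model.

(** * From bits to the random graphs *)

Section Transfer.
Context {R : realType} {d : measure_display} {T : measurableType d}.
Variables (P : probability T R) (w : forall n : nat, 'I_n -> R).
Variable a : forall n : nat, 'I_n -> 'I_n -> {RV P >-> bool}.
Hypothesis aCL : chung_lu w a.
Arguments a {n} _ _.

Definition edge_prob n (k : upair n) : R := rho w n * w (val k).1 * w (val k).2.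

Definition config n (t : T) : {ffun upair n -> bool} :=
  [ffun k => a (val k).1 (val k).2 t].

Lemma edge_prob01 n (k : upair n) : 0 <= edge_prob k <= 1.
Proof.
have [aP _ _] := aCL; have := aP n (val k).1 (val k).2 (valP k).
by rewrite /edge_prob -!lee_fin => <-; rewrite measure_ge0 probability_le1 //;
  rewrite -[X in measurable X]/(a (val k).1 (val k).2 @^-1` [set true]); exact: measurable_funPTI.
Qed.

Lemma adjacency_config n t : normalized_adjacency w (@a) n t =
  model_mx (Num.sqrt (n%:R * rho w n)) (config n t).
Proof.
have [_ asym _] := aCL; apply/matrixP => i j; rewrite !mxE ffunE /=.
by case: ifP => //= _; rewrite asym.
Qed.

Let pair_index n (k : upair n) : {n : nat & ('I_n * 'I_n)%type} :=
  Tagged (fun n => ('I_n * 'I_n)%type) (val k).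

Let pair_index_inj n : injective (@pair_index n).
Proof. by move=> k l /eqP; rewrite /pair_index eq_Tagged => /eqP/val_inj. Qed.

(** The event prescribes the value of finitely many independent bits. *)
Lemma config_event n (f : {ffun upair n -> bool}) :
  measurable [set t | config n t = f] /\
  P [set t | config n t = f] = (bern_weight (@edge_prob n) f)%:E.
Proof.
have [aP _ aI] := aCL.
pose X (k : {n : nat & ('I_n * 'I_n)%type}) : T -> bool :=
  a (tagged k).1 (tagged k).2.
pose r := [seq pair_index k | k <- enum {: upair n}].
pose B (k : {n : nat & ('I_n * 'I_n)%type}) : set bool :=
  [set b | forall l : upair n, pair_index l = k -> b = f l].
have BE l : B (pair_index l) = [set f l].
  apply/seteqP; split => b /=; first by apply.
  by move=> -> l' /pair_index_inj ->.
have E : [set t | config n t = f] = \bigcap_(k in [set` r]) X k @^-1` B k.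
  apply/seteqP; split => t /=.
    move=> tf k /= /mapP[l _ ->]; rewrite /preimage /= => l' /pair_index_inj ->.
    by rewrite -tf ffunE.
  move=> tf; apply/ffunP => l; rewrite ffunE.
  by apply: (tf (pair_index l)) => //=; rewrite map_f // mem_enum.
have mX k (A : set bool) : measurable (X k @^-1` A).
  exact: measurable_funPTI.
split.
  by rewrite E; apply: fin_bigcap_measurable.
rewrite E aI //; last first.
- by move=> k /mapP[l _ ->] /=; exact: (valP l).
- by rewrite map_inj_uniq ?enum_uniq //; exact: pair_index_inj.
rewrite big_map /bern_weight -prodEFin big_enum /=; apply: eq_bigr => l _.
rewrite BE; have := aP n (val l).1 (val l).2 (valP l); rewrite -/(edge_prob l) => al.
have tE : X (pair_index l) @^-1` [set true] = [set t | a (val l).1 (val l).2 t] by [].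
case: (f l); first by rewrite tE.
have -> : X (pair_index l) @^-1` [set false] = ~` [set t | a (val l).1 (val l).2 t].
  by apply/seteqP; split => t /=; rewrite /X /=; case: (a _ _ t).
by rewrite probability_setC -?tE // tE al.
Qed.

Lemma measure_bigsetU_le (J : Type) (r : seq J) (Q : pred J) (F : J -> set T) :
  (forall j, measurable (F j)) ->
  (P (\big[setU/set0]_(j <- r | Q j) F j) <= \sum_(j <- r | Q j) P (F j))%E.
Proof.
move=> mF; elim: r => [|j r IH]; first by rewrite !big_nil measure0.
rewrite !big_cons; case: ifP => // _.
apply: le_trans (measureU2 _ (mF j) _) _; first exact: bigsetU_measurable.
exact: leeD.
Qed.

Lemma config_prob_le n (Q : pred {ffun upair n -> bool}) :
  measurable [set t | Q (config n t)] /\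
  (P [set t | Q (config n t)] <= (bern_exp (@edge_prob n) (fun f => (Q f)%:R))%:E)%E.
Proof.
have E : [set t | Q (config n t)] =
    \big[setU/set0]_(f | Q f) [set t | config n t = f].
  rewrite -bigcup_seq_cond; apply/seteqP; split => t /=.
    by move=> Qt; exists (config n t) => //=; rewrite mem_index_enum.
  by move=> [f /= /andP[_ Qf] ->].
split; first by rewrite E; apply: bigsetU_measurable => f _; exact: (config_event f).1.
rewrite E; apply: le_trans (measure_bigsetU_le _ _ _) _.
  by move=> f; exact: (config_event f).1.
rewrite /bern_exp -sumEFin big_mkcond /=; apply: lee_sum => f _.
by case: (Q f); rewrite ?mulr1 ?mulr0 ?(config_event f).2.
Qed.

Lemma sum_inv_sq_le N : \sum_(i < N) (i.+1%:R ^+ 2)^-1 <= 2 :> R.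
Proof.
suff h : \sum_(i < N.+1) (i.+1%:R ^+ 2)^-1 <= 2 - N.+1%:R^-1 :> R.
  apply: le_trans (_ : \sum_(i < N.+1) (i.+1%:R ^+ 2)^-1 <= _).
    by rewrite [leRHS]big_ord_recr lerDl invr_ge0 exprn_ge0.
  by apply: le_trans h _; rewrite lerBlDr lerDl invr_ge0.
elim: N => [|N IH]; first by rewrite big_ord1 expr1n !invr1; lra.
rewrite big_ord_recr /=; apply: le_trans (lerD IH (lexx _)) _.
rewrite -(natr1 N.+1); set x : R := N.+1%:R.
have x0 : 0 < x by rewrite ltr0n.
rewrite -subr_ge0.
have -> : 2 - (x + 1)^-1 - (2 - x^-1 + ((x + 1) ^+ 2)^-1) = (x * (x + 1) ^+ 2)^-1.
  by field; rewrite !gt_eqF // addr_gt0.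
by rewrite invr_ge0 mulr_ge0 ?exprn_ge0 // ?ltW // addr_gt0.
Qed.

Definition esd_of n t (x : R) := esd (normalized_adjacency w (@a) n t) x.
Definition expected_esd n (x : R) :=
  mean_esd (@edge_prob n) (Num.sqrt (n%:R * rho w n)) x.

(** The Borel-Cantelli lemma: the probabilities of [esd_concentration] are
    summable over the sizes. *)
Lemma esd_ae x e : 0 < e ->
  {ae P, forall t, \forall n \near \oo, `|esd_of n t x - expected_esd n x| < e}.
Proof.
move=> e0.
pose Q n (f : {ffun upair n -> bool}) :=
  (e <= `|esd (model_mx (Num.sqrt (n%:R * rho w n)) f) x - expected_esd n x|)%R.
pose F n := [set t | Q n (config n t)].
have mF n : measurable (F n) by exact: (config_prob_le (@Q n)).1.
pose c := 64 / e ^+ 4.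
have PF n : (P (F n.+1) <= (c * (n.+1%:R ^+ 2)^-1)%:E)%E.
  apply: le_trans (config_prob_le (@Q n.+1)).2 _; rewrite lee_fin.
  by apply: esd_concentration => //; exact: edge_prob01.
have c0 : 0 <= c by rewrite divr_ge0 // exprn_ge0 // ltW.
have sumF : (\sum_(n <oo) P (F n) < +oo)%E.
  apply: (@le_lt_trans _ _ (1 + c * 2)%:E); last exact: ltry.
  apply: lime_le; first by apply: is_cvg_nneseries => n _ _; exact: measure_ge0.
  apply: nearW => N; rewrite big_mkord; case: N => [|N].
    by rewrite big_ord0 lee_fin addr_ge0 // mulr_ge0.
  rewrite big_ord_recl EFinD; apply: leeD; first exact: probability_le1.
  apply: (@le_trans _ _ (\sum_(i < N) (c * (i.+1%:R ^+ 2)^-1)%:E)%E).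
    by apply: lee_sum => i _; exact: PF.
  by rewrite sumEFin lee_fin -mulr_sumr ler_wpM2l // sum_inv_sq_le.
exists (lim_sup_set F); split.
- by apply: bigcapT_measurable => n; exact: bigcup_measurable.
- exact: lim_sup_set_cvg0.
move=> t /= nt n _ /=; apply: contrapT => nF; apply: nt.
exists n => // k /= nk; rewrite ltNge; apply/negP => ek; apply: nF.
by exists k => //; rewrite /F /Q /= -adjacency_config.
Qed.

(** Distribution functions are monotone, so that countably many points and
    tolerances will be enough. *)
Lemma esd_ae_rat : {ae P, forall t, forall (q : rat) (l : nat),
  \forall n \near \oo, `|esd_of n t (ratr q) - expected_esd n (ratr q)| < l.+1%:R^-1}.
Proof.
pose S (i : nat) t := if (unpickle i : option (rat * nat)%type) is Some (q, l) then
  \forall n \near \oo, `|esd_of n t (ratr q) - expected_esd n (ratr q)| < l.+1%:R^-1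
  else True.
have : \forall t \ae P, forall i, S i t.
  apply: ae_foralln => i; rewrite /S; case: unpickle => [[q l]|]; last exact: aeW.
  by apply: esd_ae; rewrite invr_gt0.
apply: filterS => t St q l; have := St (pickle (q, l)).
by rewrite /S pickleK.
Qed.

End Transfer.

Lemma esd_nondecreasing {R : realType} n (A : 'M[R]_n) : {homo esd A : x y / x <= y}.
Proof.
move=> x y xy; rewrite /esd ler_wpM2l ?invr_ge0 // ler_nat.
by apply: sub_count => l /= lx; apply: le_trans xy.
Qed.

(** Monotone functions that are close, at all rational points, to functions
    squeezed by [F] up to its jumps, converge to [F] at its continuity points. *)
Lemma cvg_weakly_rat {R : realType} (g G : nat -> R -> R) (F : R -> R) :
  (forall n, {homo g n : x y / x <= y}) ->
  (forall (q : rat) l, \forall n \near \oo, `|g n (ratr q) - G n (ratr q)| < l.+1%:R^-1) ->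
  (forall x e, 0 < e -> \forall n \near \oo, G n x <= F x + e) ->
  (forall x x' e, x < x' -> 0 < e -> \forall n \near \oo, F x - e <= G n x') ->
  cvg_weakly g F.
Proof.
move=> gmono gG Gub Glb x Fx; apply/cvgrPdist_le => e e0.
have e3 : 0 < e / 3 by rewrite divr_gt0.
have [l le3] : exists l : nat, l.+1%:R^-1 <= e / 3.
  exists (Num.bound (e / 3)^-1).
  rewrite -[leRHS]invrK lef_pV2 ?posrE ?invr_gt0 //; apply: ltW.
  apply: lt_trans (archi_boundP _) _; first by rewrite invr_ge0 ltW.
  by rewrite ltr_nat.
have := Fx => /cvgrPdist_le /(_ _ e3) [dl /= dl0 dF].
have Fd y : `|x - y| < dl -> `|F x - F y| <= e / 3 by apply: dF.
have xd : x < x + dl by rewrite ltrDl.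
have [q] := rat_in_itvoo xd; rewrite in_itv /= => /andP[xq qd].
have xd2 : x - dl / 2 < x by rewrite ltrBlDr ltrDl divr_gt0.
have [q'] := rat_in_itvoo xd2; rewrite in_itv /= => /andP[q'd q'x].
have Fq : `|F x - F (ratr q)| <= e / 3.
  by apply: Fd; rewrite distrC ger0_norm ?subr_ge0 ?(ltW xq) // ltrBlDl.
have Fy : `|F x - F (x - dl / 2)| <= e / 3.
  by apply: Fd; rewrite opprB addrC subrK ger0_norm ?divr_ge0 ?(ltW dl0) //; lra.
near=> n.
have h1 : `|g n (ratr q) - G n (ratr q)| < l.+1%:R^-1 by near: n; exact: gG.
have h2 : `|g n (ratr q') - G n (ratr q')| < l.+1%:R^-1 by near: n; exact: gG.
have h3 : G n (ratr q) <= F (ratr q) + e / 3 by near: n; exact: Gub.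
have h4 : F (x - dl / 2) - e / 3 <= G n (ratr q') by near: n; exact: Glb.
have h5 := gmono n _ _ (ltW xq); have h6 := gmono n _ _ (ltW q'x).
move: (lt_le_trans h1 le3) (lt_le_trans h2 le3) Fq Fy.
rewrite !ler_norml !ltr_norml; clear -h3 h4 h5 h6.
move=> /andP[? ?] /andP[? ?] /andP[? ?] /andP[? ?].
by apply/andP; split; lra.
Unshelve. all: end_near. Qed.

(** * Limits of the expected moments *)

(** With [y = ln n], the exponential series gives [y ^ M.+1 <= M.+1`! * n]. *)
Lemma ln_pow_div_cvg0 {R : realType} M :
  ln (n%:R : R) ^+ M / n%:R @[n --> \oo] --> (0 : R).
Proof.
apply/cvgrPdist_le => e e0.
pose f : R := (M.+1)`!%:R; have f0 : 0 < f by rewrite ltr0n fact_gt0.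
near=> n.
have n_big : expR (f / e) <= n%:R by near: n; exact: nbhs_infty_ger.
have n0 : 0 < n%:R :> R by apply: lt_le_trans n_big; exact: expR_gt0.
have ln_big : f / e <= ln (n%:R : R) by rewrite -[leLHS]expRK ler_ln ?posrE ?expR_gt0.
have ln0 : 0 < ln (n%:R : R) by apply: lt_le_trans ln_big; rewrite divr_gt0.
rewrite sub0r normrN ger0_norm ?divr_ge0 ?exprn_ge0 ?(ltW ln0) // ler_pdivrMr //.
have := expR_ge1Dxn M (ltW ln0); rewrite lnK ?posrE // => h.
have {}h : ln (n%:R : R) ^+ M.+1 <= n%:R * f.
  by rewrite -ler_pdivrMr //; apply: le_trans h; rewrite lerDr.
rewrite -(ler_pM2r ln0) -exprSr; apply: le_trans h _.
rewrite -mulrA [leRHS]mulrC -mulrA ler_pM2l //.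
by move: ln_big; rewrite ler_pdivrMr.
Unshelve. all: end_near. Qed.

Section Asymptotics.
Context {R : realType}.
Variable w : forall n : nat, 'I_n -> R.
Arguments w {n} _.
Hypotheses (w_ge0 : expected_degrees (@w)) (A2 : assumption_A2 (@w))
  (A3 : assumption_A3 (@w)).

Local Notation rh := (rho (@w)).
Definition nweight n (i : 'I_n) : R := n%:R * rh n * w i.
Definition mesh n : R := Num.sqrt (n%:R * rh n).
Local Notation x := nweight.
Local Notation s := mesh.

Lemma rho_gt0 n : (0 < n)%N -> 0 < rh n.
Proof. by move=> n0; rewrite invr_gt0; have [_] := w_ge0 n0. Qed.

Lemma mesh_gt0 n : (0 < n)%N -> 0 < s n.
Proof. by move=> n0; rewrite sqrtr_gt0 mulr_gt0 ?rho_gt0 ?ltr0n. Qed.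

Lemma mesh_sq n : (0 < n)%N -> s n ^+ 2 = n%:R * rh n.
Proof. by move=> n0; rewrite sqr_sqrtr // mulr_ge0 // ltW // rho_gt0. Qed.

Lemma nweight_sum n : (0 < n)%N -> \sum_(i < n) x i = n%:R.
Proof.
move=> n0; rewrite -mulr_sumr /rho -mulrA mulVf ?mulr1 //.
by have [_ h] := w_ge0 n0; rewrite gt_eqF.
Qed.

Lemma edge_prob_nweight n (i j : 'I_n) : (0 < n)%N ->
  edge_prob (@w) (edge i j) = x i * x j / (n%:R * s n ^+ 2).
Proof.
move=> n0; have nR : n%:R != 0 :> R by rewrite pnatr_eq0 -lt0n.
have r0 : rh n != 0 by rewrite gt_eqF // rho_gt0.
rewrite mesh_sq // /edge_prob /nweight /=.
by case: ifP => _ /=; field; rewrite nR r0.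
Qed.

Lemma nweight_bounded : exists2 C : R, 0 <= C &
  \forall n \near \oo, forall i : 'I_n, 0 <= x i <= C.
Proof.
have [_ _ _ /eqO_exP[C /= C0 nC] _] := A3; exists C; first exact: ltW.
near=> n => i.
have n0 : (0 < n)%N by near: n; exact: nbhs_infty_gt.
have h : `|n%:R * rh n * wmax (@w) n| <= C * `|1| by near: n.
have wi0 : 0 <= w i by have [] := w_ge0 n0.
have nr0 : 0 <= n%:R * rh n by rewrite mulr_ge0 // ltW // rho_gt0.
rewrite mulr_ge0 //=; move: h; rewrite normr1 mulr1 => /(le_trans (ler_norm _)).
by apply: le_trans; rewrite ler_wpM2l // le_bigmax.
Unshelve. all: end_near. Qed.

Lemma mesh_sq_cvg0 : s n ^+ 2 @[n --> \oo] --> (0 : R).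
Proof.
have [_ _ /eqoP no _ _] := A3; apply/cvgrPdist_le => e e0; near=> n.
have n0 : (0 < n)%N by near: n; exact: nbhs_infty_gt.
rewrite sub0r normrN mesh_sq //.
have : `|n%:R * rh n| <= e * `|1| by near: n; exact: no.
by rewrite normr1 mulr1.
Unshelve. all: end_near. Qed.

Lemma mesh_le1 : \forall n \near \oo, s n <= 1.
Proof.
near=> n; have : `|0 - s n ^+ 2| <= 1.
  by near: n; move/cvgrPdist_le: mesh_sq_cvg0; apply.
by rewrite sub0r normrN normrX ger0_norm ?sqrtr_ge0 // expr_le1 ?sqrtr_ge0.
Unshelve. all: end_near. Qed.

(** The mean degree is at most the maximal one, hence logarithmic: negative
    powers of the mesh are negligible against [n]. *)
Lemma mesh_pow_cvg0 M : (n%:R * s n ^+ M)^-1 @[n --> \oo] --> (0 : R).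
Proof.
have [_ _ _ _ [/eqO_exP[c /= c0 wc] _]] := A3.
have lim0 : c ^+ M * (ln (n%:R : R) ^+ M / n%:R) @[n --> \oo] --> (0 : R).
  by rewrite -(mulr0 (c ^+ M)); apply: cvgMr; exact: ln_pow_div_cvg0.
apply: (squeeze_cvgr _ (cvg_cst 0) lim0); near=> n.
have n1 : (1 <= n)%N by near: n; exact: nbhs_infty_ge.
have nR : 0 < n%:R :> R by rewrite ltr0n.
have s0 := mesh_gt0 n1; have s1 : s n <= 1 by near: n; exact: mesh_le1.
have ln0 : 0 <= ln (n%:R : R) by rewrite ln_ge0 // ler1n.
have h : `|wmax (@w) n| <= c * `|ln (n%:R : R)| by near: n.
have {}h : wmax (@w) n <= c * ln (n%:R : R).
  by apply: le_trans (ler_norm _) _; rewrite (ger0_norm ln0) in h.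
rewrite invr_ge0 mulr_ge0 ?exprn_ge0 ?(ltW s0) //=.
apply: (@le_trans _ _ (((s n ^+ 2)^-1) ^+ M / n%:R)).
  rewrite invfM mulrC ler_wpM2r ?invr_ge0 // exprVn lef_pV2 ?posrE ?exprn_gt0 //.
  by rewrite -exprM; apply: ler_wiXn2l; rewrite ?(ltW s0) // leq_pmull.
rewrite mulrA -exprMn ler_wpM2r ?invr_ge0 // lerXn2r ?nnegrE ?invr_ge0 ?exprn_ge0 ?(ltW s0) //.
  by rewrite mulr_ge0 // ltW.
apply: le_trans h; rewrite mesh_sq // invfM invrK ler_pdivrMl //.
rewrite mulr_natl -[X in _ *+ X]card_ord -sumr_const; apply: ler_sum => i _.
exact: le_bigmax.
Unshelve. all: end_near. Qed.

Lemma walk_error_cvg0 C K : walk_error n (s n) C K @[n --> \oo] --> (0 : R).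
Proof.
rewrite /walk_error; set Db := (C + 1) ^+ K.
have t1 : C ^+ 2 * Db / n%:R @[n --> \oo] --> (0 : R).
  rewrite -(mulr0 (C ^+ 2 * Db)); apply: cvgMr.
  by have := mesh_pow_cvg0 0; under eq_fun do rewrite expr0 mulr1.
have t2 : s n ^+ 2 * Db @[n --> \oo] --> (0 : R).
  by rewrite -(mul0r Db); apply: cvgMl; exact: mesh_sq_cvg0.
have t3 : C ^+ 2 * ((K%:R + 1 + C) / s n ^+ 2) ^+ K / (n%:R * s n ^+ K.+1)
    @[n --> \oo] --> (0 : R).
  have -> : (fun n => C ^+ 2 * ((K%:R + 1 + C) / s n ^+ 2) ^+ K / (n%:R * s n ^+ K.+1)) =
     (fun n => C ^+ 2 * (K%:R + 1 + C) ^+ K * (n%:R * s n ^+ (2 * K + K.+1))^-1).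
    apply/funext => n; rewrite expr_div_n -exprM exprD !invfM.
    by move: (_ ^+ K) (s n ^+ _)^-1 (s n ^+ _)^-1 => a b c; ring.
  rewrite -(mulr0 (C ^+ 2 * (K%:R + 1 + C) ^+ K)); apply: cvgMr.
  exact: mesh_pow_cvg0.
have := cvgD (cvgD t1 t2) t3; rewrite !addr0.
exact.
Qed.

(** The zeroth moment is 1 for every size but 0. *)
Definition lim_weight k : R := if k is 0 then 1 else Lambda (@w) k.

Lemma emp_moment_cvg k : emp_moment (@x n) k @[n --> \oo] --> lim_weight k.
Proof.
case: k => [|k]; last first.
  exact: (A2 (ltn0Sn k)).
apply: cvg_near_cst; near=> n.
have n0 : (0 < n)%N by near: n; exact: nbhs_infty_gt.
rewrite /emp_moment; under eq_bigr do rewrite expr0.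
by rewrite sumr_const card_ord mulVf // pnatr_eq0 -lt0n.
Unshelve. all: end_near. Qed.

Lemma luk_cvg (L : nat -> nat -> R) (l : nat -> R) m k :
  (forall k, L n k @[n --> \oo] --> l k) -> luk (L n) m k @[n --> \oo] --> luk l m k.
Proof.
move=> Ll; elim: m k => [|m IH] k; first exact: cvg_cst.
case: k => [|k]; first exact: cvg_cst.
rewrite lukSS; under eq_fun do rewrite lukSS.
by apply: cvgr_sum => j; apply: cvgM; [exact: Ll|exact: IH].
Qed.

Definition limit_moment k : R :=
  if odd k then 0 else if k is 0 then 1 else even_moment (Lambda (@w)) k./2.

Let stack_mean n k : R := n%:R^-1 * \sum_(u < n) stack_sum (@x n) k [:: x u].

Lemma stack_mean_cvg k : stack_mean n k @[n --> \oo] --> limit_moment k.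
Proof.
have [ok|ek] := boolP (odd k).
  rewrite /limit_moment ok; apply: cvg_near_cst; apply: nearW => n.
  by rewrite /stack_mean big1 ?mulr0 // => u _; rewrite stack_sum_parity.
have kE : k = (k./2).*2 by rewrite -[LHS]odd_double_half (negPf ek).
have -> : limit_moment k = \sum_(i < k./2.+1) lim_weight i * luk lim_weight k./2 i.
  rewrite /limit_moment (negPf ek); case: {ek}k kE => [|k] kE.
    by rewrite big_ord1 mul1r.
  by rewrite luk_sum_even_moment //; lia.
have -> : stack_mean^~ k = stack_mean^~ (k./2.*2) by rewrite -kE.
apply: cvg_trans (_ : (fun n => \sum_(i < k./2.+1)
    emp_moment (@x n) i * luk (emp_moment (@x n)) k./2 i) @ \oo --> _).
  apply: near_eq_cvg; near=> n.
  have n0 : (0 < n)%N by near: n; exact: nbhs_infty_gt.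
  by rewrite /stack_mean mean_stack_sum.
apply: cvgr_sum => i; apply: cvgM; first exact: emp_moment_cvg.
by apply: luk_cvg => j; exact: emp_moment_cvg.
Unshelve. all: end_near. Qed.

(** The moments are compared with the stack sums of the same weights, which
    are polynomials in finitely many of the weight moments. *)
Lemma mean_moment_cvg k :
  mean_moment (@edge_prob R (@w) n) (s n) k @[n --> \oo] --> limit_moment k.
Proof.
have [C C0 xC] := nweight_bounded.
pose err n := walk_error n (s n) C k * (C + k%:R *+ 2 + 3) ^+ k.
have err0 : err n @[n --> \oo] --> (0 : R).
  by rewrite -(mul0r ((C + k%:R *+ 2 + 3) ^+ k)); apply: cvgMl; exact: walk_error_cvg0.
suff diff0 : mean_moment (@edge_prob R (@w) n) (s n) k - stack_mean n k
    @[n --> \oo] --> (0 : R).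
  rewrite -(add0r (limit_moment k)).
  rewrite (_ : (fun n => _) = (fun n => mean_moment (@edge_prob R (@w) n) (s n) k
    - stack_mean n k + stack_mean n k)); last by apply/funext => n; rewrite subrK.
  exact: cvgD diff0 (@stack_mean_cvg k).
apply/cvgrPdist_le => e e0; near=> n.
have n0 : (0 < n)%N by near: n; exact: nbhs_infty_gt.
have s1 : s n <= 1 by near: n; exact: mesh_le1.
have x01 : forall i : 'I_n, 0 <= x i <= C by near: n.
have errn : `|0 - err n| <= e by near: n; move/cvgrPdist_le: err0; apply.
have nR : 0 < n%:R :> R by rewrite ltr0n.
rewrite sub0r normrN mean_momentE /stack_mean -mulrBr -sumrB normrM.
rewrite ger0_norm ?invr_ge0 // ler_pdivrMl //.
apply: le_trans (ler_norm_sum _ _ _) _.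
apply: (@le_trans _ _ (\sum_(r < n) e)); last first.
  by rewrite sumr_const card_ord mulr_natl.
apply: ler_sum => r _.
apply: le_trans (walk_sum_root (@edge_sym n) (@edge_inj n) n0 (mesh_gt0 n0) s1 x01
  (nweight_sum n0) (fun i j => edge_prob_nweight i j n0) r (leqnn k)) _.
apply: le_trans errn; rewrite sub0r normrN; exact: ler_norm.
Unshelve. all: end_near. Qed.

(** The bound on the stack sums passes to the limit. *)
Lemma limit_moment_growth : exists2 K, 0 <= K & moment_growth K limit_moment.
Proof.
have [C C0 xC] := nweight_bounded; exists (C + 1); first by rewrite addr_ge0.
move=> j; rewrite leNgt; apply/negP => lt.
have near_gt : \forall n \near \oo, (C + 1) ^+ j.*2 < stack_mean n j.*2.
  exact: (cvgr_gt _ (@stack_mean_cvg j.*2) _ lt).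
near \oo => n.
have n0 : (0 < n)%N by near: n; exact: nbhs_infty_gt.
have x01 : forall i : 'I_n, 0 <= x i <= C by near: n.
have : (C + 1) ^+ j.*2 < stack_mean n j.*2 by near: n.
apply/negP; rewrite -leNgt /stack_mean ler_pdivrMl ?ltr0n //.
apply: (@le_trans _ _ (\sum_(u < n) (C + 1) ^+ j.*2)); last first.
  by rewrite sumr_const card_ord mulr_natl.
apply: ler_sum => u _.
have st : all (fun a => 0 <= a <= C) [:: x u] by rewrite /= x01.
by have /andP[] := stack_sum_ge0_le n0 x01 (nweight_sum n0) j.*2 st.
Unshelve. all: end_near. Qed.

Hypothesis p01 : forall n (k : upair n), 0 <= edge_prob (@w) k <= 1.

Lemma limit_moment_ge0 (q : {poly R}) : (forall y, 0 <= q.[y]) -> 0 <= mom limit_moment q.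
Proof.
move=> q0; rewrite leNgt; apply/negP => lt.
have cvgq : mom (mean_moment (@edge_prob R (@w) n) (s n)) q @[n --> \oo] --> mom limit_moment q.
  by apply: cvgr_sum => i; apply: cvgMr; exact: mean_moment_cvg.
near \oo => n.
have n0 : (0 < n)%N by near: n; exact: nbhs_infty_gt.
have : mom (mean_moment (@edge_prob R (@w) n) (s n)) q < 0.
  by near: n; exact: (cvgr_lt _ cvgq _ lt).
apply/negP; rewrite -leNgt.
exact: (cdf_mom_ge0 (mean_is_cdf_of (s n) (@p01 n) n0)).
Unshelve. all: end_near. Qed.

End Asymptotics.

(** * Weak convergence *)

Theorem theorem2 (R : realType) (d : measure_display) (T : measurableType d)
    (P : probability T R) (w : forall n : nat, 'I_n -> R)
    (a : forall n : nat, 'I_n -> 'I_n -> {RV P >-> bool}) :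
  expected_degrees w ->
  assumption_A1 w -> assumption_A2 w -> assumption_A3 w ->
  chung_lu w a ->
  exists F : probability (measurableTypeR R) R,
    [/\ {ae P, forall t,
          cvg_weakly (fun n => esd (normalized_adjacency w a n t))
                     (distribution_function F)},
        determined_by_moments F,
        forall s : nat, (0 < s)%N ->
          has_moment F (2 * s) (even_moment (Lambda w) s)
      & forall s : nat, has_moment F (2 * s + 1) 0].
Proof.
move=> w_ge0 _ A2 A3 aCL.
have p01 n k := edge_prob01 aCL (n := n) k.
set m := limit_moment w.
have m_ge0 := limit_moment_ge0 w_ge0 A2 A3 p01.
have [K K0 mK] := limit_moment_growth w_ge0 A2 A3.
have m0 : m 0 = 1 by [].
have [F [FE Fm Fdet]] := probability_of_moments mK K0 m0 m_ge0.
exists F; split => //.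
- have ae := esd_ae_rat aCL; apply: filterS ae => t close.
  have cdf_near : \forall n \near \oo,
      is_cdf_of (mean_moment (@edge_prob R w n) (mesh w n)) (expected_esd w n).
    near=> n; apply: (mean_is_cdf_of _ (@p01 n)).
    by near: n; exact: nbhs_infty_gt.
  have mcvg := mean_moment_cvg w_ge0 A2 A3.
  rewrite FE; apply: (cvg_weakly_rat _ close).
  + by move=> n; exact: esd_nondecreasing.
  + by move=> x e e0; exact: (cdf_limit_ub m_ge0 x cdf_near mcvg e0).
  + by move=> x x' e xx' e0; exact: (cdf_limit_lb mK K0 m0 m_ge0 cdf_near mcvg xx' e0).
- move=> s s0; have := Fm (2 * s)%N; rewrite /m /limit_moment mul2n odd_double doubleK.
  by case: s s0.
- move=> s; have := Fm (2 * s + 1)%N.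
  by rewrite /m /limit_moment mul2n addn1 /= odd_double.
Unshelve. all: end_near. Qed.
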